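(* Consider either the white noise model or the Gaussian sequence model with noise level $n^{-1/2}$, and let $T$ be a linear functional. Let $\mathcal{F}=\bigcup_{i=1}^k\mathcal{F}_i$ where $k\ge 2$ and $\mathcal{F}_1,\dots,\mathcal{F}_k$ are closed convex sets with $\mathcal{F}_i\cap\mathcal{F}_j\neq\varnothing$ for all $i,j$. Let $M>0$ and let $\hat T_1,\dots,\hat T_k$ be linear estimators satisfying $$\sup_{f\in\mathcal{F}_i}E_f(\hat T_i-Tf)^2\le M^2\,\omega^2\Big(\tfrac1{\sqrt n},\mathcal{F}_i\Big),\qquad i=1,\dots,k,$$ and let $\hat T^*=\hat T_{\hat i}$ be the estimator built from them as described in the context. Then for every $p\ge 1$, $$\sup_{f\in\mathcal{F}}E_f|\hat T^*-Tf|^p\le C(p)\,M^p(\ln k)^{p/2}\,\omega^p\Big(\tfrac1{\sqrt n},\mathcal{F}\Big),$$ where the constant $C(p)$ depends on $p$ and is independent of $M$, $k$ and $n$.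
   Context: **Models.** White noise model: one observes $dY(t)=f(t)\,dt+n^{-1/2}dW(t)$ on an interval, $W$ a standard Brownian motion. Sequence model: one observes $Y(i)=f(i)+n^{-1/2}\varepsilon_i$, $\varepsilon_i$ i.i.d. standard normal. $\langle\cdot,\cdot\rangle$ and $\|\cdot\|_2$ are the $L_2$ (resp. $\ell_2$) inner product and norm; parameter sets are subsets of this Hilbert space, ''closed'' is with respect to $\|\cdot\|_2$, and $T$ is a linear functional on a linear space containing the parameter sets. $E_f$ is expectation when the true parameter is $f$. A linear estimator has the form $a+\int u(t)\,dY(t)$ (white noise) or $a+\sum_i u(i)Y(i)$ (sequence), with $a\in\mathbb{R}$ and $u$ in the Hilbert space; under $f$ it is normal with mean $a+\langle u,f\rangle$ and variance $\|u\|_2^2/n$. **Modulus.** $\omega(\varepsilon,\mathcal{F},\mathcal{G})=\sup\{Tg-Tf:\|g-f\|_2\le\varepsilon,\ f\in\mathcal{F},\ g\in\mathcal{G}\}$ and $\omega(\varepsilon,\mathcal{F})=\omega(\varepsilon,\mathcal{F},\mathcal{F})$. It is assumed that $\omega(1,\mathcal{F}_i,\mathcal{F}_j)>0$ for $i\ne j$ (and that the moduli at $1/\sqrt n$ are finite, as needed for the construction). **Auxiliary quantities.** For $V\ge0$ put $B(V,\mathcal{F},\mathcal{G})=\frac12\sup_{\varepsilon>0}(\omega(\varepsilon,\mathcal{F},\mathcal{G})-\sqrt{nV}\,\varepsilon)$. If $0<B(V,\mathcal{F},\mathcal{G})<\infty$, $\varepsilon(V,\mathcal{F},\mathcal{G})$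 is the smallest $\varepsilon\geq 0$ maximizing $\omega(\varepsilon,\mathcal{F},\mathcal{G})-\sqrt{nV}\,\varepsilon$. If $B(V,\mathcal{F},\mathcal{G})=0$, $B(V',\mathcal{F},\mathcal{G})>0$ for all $0\le V'<V$, and $\omega(\varepsilon,\mathcal{F},\mathcal{G})=\sqrt{nV}\,\varepsilon$ on some interval $[0,\varepsilon_0]$ with $\varepsilon_0>0$, then $\varepsilon(V,\mathcal{F},\mathcal{G})$ is the largest $\varepsilon\le 1/\sqrt n$ with $\omega(\varepsilon,\mathcal{F},\mathcal{G})=\sqrt{nV}\,\varepsilon$. **The estimators $\hat T_{i,j}$ ($i\ne j$).** Put $\mathcal{G}=\mathcal{F}_i$ and $\mathcal{H}=\mathcal{F}_j$ and $V=V_{i,j}=\omega^2(\frac1{\sqrt n},\mathcal{G},\mathcal{H})$; with this choice $0<\varepsilon(V,\mathcal{G},\mathcal{H})\le 1/\sqrt n$. (A) If there are $f\in\mathcal{G}$, $g\in\mathcal{H}$ with $\|g-f\|_2=\varepsilon_V:=\varepsilon(V,\mathcal{G},\mathcal{H})$ and $Tg-Tf=\omega(\varepsilon_V,\mathcal{G},\mathcal{H})$, set $u=(g-f)/\varepsilon_V$, $a=T(\frac{f+g}2)-\sqrt{nV}\langle u,\frac{f+g}2\rangle$. (B) Otherwise, let $\mathcal{G}_m,\mathcal{H}_m$ be the intersections of $\mathcal{G},\mathcal{H}$ with the closed $\|\cdot\|_2$-ball of radius $m$ centered at $0$. If $B(V,\mathcal{G},\mathcal{H})>0$ let $V_m=V$;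 if $B(V,\mathcal{G},\mathcal{H})=0$ choose, for all large $m$, $V_m<V$ with $0<B(V_m,\mathcal{G}_m,\mathcal{H}_m)\le\frac1m$. Let $\varepsilon_m=\varepsilon(V_m,\mathcal{G}_m,\mathcal{H}_m)$ (which is in $(0,2m)$ for large $m$), let $f_m\in\mathcal{G}_m$, $g_m\in\mathcal{H}_m$ attain $\omega(\varepsilon_m,\mathcal{G}_m,\mathcal{H}_m)$ with $\|g_m-f_m\|_2=\varepsilon_m$, and set $u_m=(g_m-f_m)/\varepsilon_m$, $a_m=T(\frac{f_m+g_m}2)-\sqrt{nV_m}\langle u_m,\frac{f_m+g_m}2\rangle$. Along a subsequence $u_m\to u$ weakly and $a_m\to a\in\mathbb{R}$; fix such a limit $(u,a)$. In both cases $\hat T_{i,j}=a+\sqrt{nV}\int u\,dY$ (white noise), resp. $a+\sqrt{nV}\sum_l u(l)Y(l)$ (sequence). These estimators have variance at most $\omega^2(\frac1{\sqrt n},\mathcal{F}_i,\mathcal{F}_j)$, and satisfy $\sup_{f\in\mathcal{F}_i}(E_f\hat T_{i,j}-Tf)\le\frac12\omega(\frac1{\sqrt n},\mathcal{F}_i,\mathcal{F}_j)$ and $\inf_{f\in\mathcal{F}_j}(E_f\hat T_{i,j}-Tf)\ge-\frac12\omega(\frac1{\sqrt n},\mathcal{F}_i,\mathcal{F}_j)$. **The estimator $\hat T^*$.** For $i\neq j$, $$\hat z^u_{i,j}=\frac{\hat T_{i,j}-\hat T_i}{\omega(\frac1{\sqrt n},\mathcal{F}_i,\mathcal{F}_j)+M\omega(\frac1{\sqrt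 n},\mathcal{F}_i)},\qquad \hat z^l_{i,j}=\frac{\hat T_i-\hat T_{j,i}}{\omega(\frac1{\sqrt n},\mathcal{F}_j,\mathcal{F}_i)+M\omega(\frac1{\sqrt n},\mathcal{F}_i)},$$ $\hat z_{i,j}=\max(\hat z^u_{i,j},\hat z^l_{i,j})$, $\hat i=\arg\min_i\big(\sup_{j\ne i}\hat z_{i,j}\big)$, and $\hat T^*=\hat T_{\hat i}$. *)

(* Defs.v *)
From HB Require Import structures.
From mathcomp Require Import all_boot all_order all_algebra.
From mathcomp Require Import all_classical all_reals all_analysis.

Set Implicit Arguments.
Unset Strict Implicit.
Unset Printing Implicit Defensive.

Import Order.TTheory GRing.Theory Num.Theory.
Import numFieldNormedType.Exports.

Local Open Scope classical_set_scope.
Local Open Scope ring_scope.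

(* Square-integrable functions.  The library's quotient LspaceType carries no
   linear structure, so the Hilbert space L2(mu) is represented by LfunType,
   whose elements are functions rather than classes; l2norm is then a
   seminorm whose null space consists of the functions that vanish
   mu-almost everywhere. *)
Notation L2 mu := (LfunType mu (lee1n 2)).

Section hilbert.
Context d (X : measurableType d) (R : realType) (mu : {measure set X -> \bar R}).
Implicit Types (f g u : L2 mu) (F G H D : set (L2 mu)) (T : L2 mu -> R).

Definition inner f g : R := \int[mu]_x (f x * g x).

Definition l2norm f : R := fine 'N[mu]_2%:E[EFin \o f]%E.

Definition l2closed F : Prop :=
  forall f, (forall e : R, 0 < e -> exists2 g, F g & l2norm (g - f) <= e) -> F f.

(* T is a linear functional on the linear space D.  Because elements of L2 mu
   are functions, T must not distinguish almost everywhere equal elements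
   of D.  T need not be bounded, and its values off D are irrelevant. *)
Definition linear_functional_on D T : Prop :=
  (forall (c : R) f g, D f -> D g ->
     D (c *: f + g) /\ T (c *: f + g) = c * T f + T g) /\
  (forall f g, D f -> D g -> (f : X -> R) = g %[ae mu] -> T f = T g).

Definition modulus T (e : R) F G : \bar R :=
  ereal_sup [set x | exists f g,
    [/\ F f, G g, l2norm (g - f) <= e & x = (T g - T f)%:E]].

Definition l2ball (r : R) : set (L2 mu) := [set f | l2norm f <= r].

Section estimators.
Context (T : L2 mu -> R) (n : nat).

Definition rate : R := (Num.sqrt n%:R)^-1.

Definition excess (V : R) F G (e : R) : \bar R :=
  (modulus T e F G - (Num.sqrt (n%:R * V) * e)%:E)%E.

Definition excess_half_sup (V : R) F G : \bar R :=
  (2^-1%:E * ereal_sup [set excess V F G e | e in [set e : R | (0 < e)%R]])%E.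

Definition excess_maximizer (V : R) F G (e : R) : Prop :=
  0 <= e /\ forall e', 0 <= e' -> (excess V F G e' <= excess V F G e)%E.

(* epsilon(V, F, G) as a functional relation: the smallest maximizer of the
   excess, or, in the degenerate case where the modulus is linear with slope
   sqrt (n V) near 0, the right end of that linear piece within [0, rate].
   No e is related to V, F, G when neither case applies. *)
Definition is_epsilon (V : R) F G (e : R) : Prop :=
  [/\ (0 < excess_half_sup V F G < +oo)%E,
      excess_maximizer V F G e &
      forall e', excess_maximizer V F G e' -> e <= e']
  \/
  [/\ excess_half_sup V F G = 0%E,
      (forall V', 0 <= V' < V -> (0 < excess_half_sup V' F G)%E),
      (exists2 e0, 0 < e0 & forall e', 0 <= e' <= e0 ->
         modulus T e' F G = (Num.sqrt (n%:R * V) * e')%:E),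
      0 <= e <= rate /\ modulus T e F G = (Num.sqrt (n%:R * V) * e)%:E &
      forall e', 0 <= e' <= rate ->
        modulus T e' F G = (Num.sqrt (n%:R * V) * e')%:E -> e' <= e].

Definition extremal_pair (V : R) G H (e : R) f g : Prop :=
  [/\ is_epsilon V G H e, G f, H g, l2norm (g - f) = e &
      (T g - T f)%:E = modulus T e G H].

Definition direction (e : R) f g : L2 mu := e^-1 *: (g - f).

Definition intercept (V e : R) f g : R :=
  T (2^-1 *: (f + g)) -
  Num.sqrt (n%:R * V) * inner (direction e f g) (2^-1 *: (f + g)).

Definition pair_variance G H : R := fine (modulus T rate G H) ^+ 2.

Definition attained_coefs G H (a : R) u : Prop :=
  let V := pair_variance G H in
  exists e f g, [/\ extremal_pair V G H e f g,
    u = direction e f g & a = intercept V e f g].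

(* Only large m matter, as the truncations of G and H to balls need not
   intersect for small m. *)
Definition truncated_coefs G H (a : R) u : Prop :=
  let V := pair_variance G H in
  exists (Vm em : R^nat) (fm gm : nat -> L2 mu) (phi : nat -> nat),
  let Gm m := G `&` l2ball m%:R in
  let Hm m := H `&` l2ball m%:R in
  let um m := direction (em m) (fm m) (gm m) in
  let am m := intercept (Vm m) (em m) (fm m) (gm m) in
  [/\ ((0 < excess_half_sup V G H)%E -> forall m, Vm m = V),
      (excess_half_sup V G H = 0%E -> \forall m \near \oo,
         0 <= Vm m < V /\
         (0 < excess_half_sup (Vm m) (Gm m) (Hm m) <= (m%:R^-1)%:E)%E),
      (\forall m \near \oo,
         extremal_pair (Vm m) (Gm m) (Hm m) (em m) (fm m) (gm m)),
      increasing_seq phi &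
      (forall h : L2 mu, inner (um (phi j)) h @[j --> \oo] --> inner u h) /\
      am (phi j) @[j --> \oo] --> a].

(* (a, u) are the coefficients of an estimator a + sqrt (n V) * int u dY,
   V = pair_variance G H, whose bias is at most omega / 2 on G and at least
   - omega / 2 on H, with omega = modulus T rate G H. *)
Definition pair_coefs G H (a : R) u : Prop :=
  attained_coefs G H a u \/
  (~ (exists e f g, extremal_pair (pair_variance G H) G H e f g) /\
   truncated_coefs G H a u).

End estimators.
End hilbert.

Definition lebesgue_on (R : realType) (I : interval R) :
    {measure set (measurableTypeR R) -> \bar R} :=
  mrestr (@lebesgue_measure R) (measurable_itv I).

Definition counting_on (R : realType) (A : set nat) :
    {measure set nat -> \bar R} :=
  mrestr (@counting nat R) (Logic.I : measurable A).

Section noise.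
Context dO (Omega : measurableType dO) (R : realType) (P : probability Omega R).

Definition has_law (Z : Omega -> R) (nu : set R -> \bar R) : Prop :=
  measurable_fun setT Z /\
  forall A : set R, measurable A -> P (Z @^-1` A) = nu A.

Definition mutually_independent (D : set nat) (Z : nat -> Omega -> R) : Prop :=
  forall s : seq nat, uniq s -> [set` s] `<=` D ->
  forall A : nat -> set R, (forall i, measurable (A i)) ->
  P (\bigcap_(i in [set` s]) (Z i @^-1` A i)) =
  (\prod_(i <- s) P (Z i @^-1` A i))%E.

(* Standard Brownian motion indexed by the interval I, up to its starting
   value: only the increments of W enter the white noise dW. *)
Definition brownian_motion (I : interval R) (W : R -> Omega -> R) : Prop :=
  [/\ forall t, t \in I -> measurable_fun setT (W t),
      forall s t, s \in I -> t \in I -> s < t ->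
        has_law (fun w => W t w - W s w) (normal_prob 0 (Num.sqrt (t - s))),
      forall t : R^nat, (forall l, t l \in I) -> nondecreasing_seq t ->
        mutually_independent setT (fun l w => W (t l.+1) w - W (t l) w) &
      {ae P, forall w, {within [set` I], continuous (fun t => W t w)}}].

(* Z is a version of the Wiener integral of u on I, the L2(P)-limit of the
   integrals of step functions converging to u in L2(I). *)
Definition wiener_integral (I : interval R) (W : R -> Omega -> R)
    (u : R -> R) (Z : Omega -> R) : Prop :=
  measurable_fun setT Z /\
  forall e : R, 0 < e -> exists (N : nat) (t c : R^nat),
  [/\ forall l, t l \in I, nondecreasing_seq t,
      (\int[lebesgue_measure]_(x in [set` I])
         ((u x - \sum_(l < N) c l * \1_(`]t l, t l.+1]%classic) x) ^+ 2)%:E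
       <= e%:E)%E &
      ('E_P[fun w => ((Z w - \sum_(l < N) c l * (W (t l.+1) w - W (t l) w))
                      ^+ 2)%R] <= e%:E)%E].

Definition iid_standard_normal (A : set nat) (eps : nat -> Omega -> R) : Prop :=
  (forall i, A i -> has_law (eps i) (normal_prob 0 1)) /\
  mutually_independent A eps.

(* Z is a version of the L2(P)-convergent series of u i * eps i over A. *)
Definition gaussian_series (A : set nat) (eps : nat -> Omega -> R)
    (u : nat -> R) (Z : Omega -> R) : Prop :=
  measurable_fun setT Z /\
  'E_P[fun w => ((Z w - \sum_(i < N | (i : nat) \in A) u i * eps i w) ^+ 2)%R]%E
    @[N --> \oo] --> 0%E.

(* gaussian_noise J, for J a function on L2 mu: L2 mu is the parameter space
   and J the noise functional (J u is int u dW, resp. sum_i u i * eps i) of a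
   white noise model on an interval I, or of a sequence model with index set
   A, a finite or infinite set of natural numbers.  In the latter, L2 mu is
   l2(A). *)
Inductive gaussian_noise : forall d (X : measurableType d)
    (mu : {measure set X -> \bar R}), (L2 mu -> Omega -> R) -> Prop :=
| white_noise (I : interval R) (W : R -> Omega -> R)
    (J : L2 (lebesgue_on I) -> Omega -> R) of
    brownian_motion I W &
    (forall u : L2 (lebesgue_on I), wiener_integral I W u (J u)) :
    gaussian_noise J
| gaussian_sequence (A : set nat) (eps : nat -> Omega -> R)
    (J : L2 (counting_on R A) -> Omega -> R) of
    iid_standard_normal A eps &
    (forall u : L2 (counting_on R A), gaussian_series A eps u (J u)) :
    gaussian_noise J.

Section observation.
Context d (X : measurableType d) (mu : {measure set X -> \bar R}).
Context (J : L2 mu -> Omega -> R) (n : nat).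

(* int u dY, resp. sum_i u i * Y i, when the true parameter is f, i.e. for
   dY = f dt + n^{-1/2} dW, resp. Y i = f i + n^{-1/2} eps i. *)
Definition obs (u f : L2 mu) (w : Omega) : R := inner u f + rate R n * J u w.

Context (T : L2 mu -> R) (k : nat) (F : 'I_k -> set (L2 mu)) (M : R).
Context (a : 'I_k -> R) (u : 'I_k -> L2 mu).
Context (ap : 'I_k -> 'I_k -> R) (up : 'I_k -> 'I_k -> L2 mu).

Definition omega (i j : 'I_k) : R := fine (modulus T (rate R n) (F i) (F j)).

Definition That (i : 'I_k) (f : L2 mu) (w : Omega) : R :=
  a i + obs (u i) f w.

Definition That_pair (i j : 'I_k) (f : L2 mu) (w : Omega) : R :=
  ap i j + Num.sqrt (n%:R * pair_variance T n (F i) (F j)) * obs (up i j) f w.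

Definition zhat_u (i j : 'I_k) (f : L2 mu) (w : Omega) : R :=
  (That_pair i j f w - That i f w) / (omega i j + M * omega i i).

Definition zhat_l (i j : 'I_k) (f : L2 mu) (w : Omega) : R :=
  (That i f w - That_pair j i f w) / (omega j i + M * omega i i).

Definition zhat (i j : 'I_k) (f : L2 mu) (w : Omega) : R :=
  Num.max (zhat_u i j f w) (zhat_l i j f w).

Definition zhat_sup (i : 'I_k) (f : L2 mu) (w : Omega) : R :=
  sup [set zhat i j f w | j in [set j | j != i]].

(* An arbitrary measurable way of breaking ties in the arg min is allowed. *)
Definition is_selector (ihat : L2 mu -> Omega -> 'I_k) : Prop :=
  forall f, (forall i, measurable (ihat f @^-1` [set i])) /\
  forall w i, zhat_sup (ihat f w) f w <= zhat_sup i f w.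

Definition That_star (ihat : L2 mu -> Omega -> 'I_k) (f : L2 mu) (w : Omega) : R :=
  That (ihat f w) f w.

End observation.
End noise.

(* Main.v *)
(* Let w i j be the modulus of continuity at n^{-1/2} between F i and F j.  At
   an extremal pair (f, g) of G x H, the map
     (f', g') |-> T g' - T f' - sqrt (n V) |g' - f'|
   is maximal, and its first-order condition says that the bias of the
   estimator with direction g - f is at most half the maximum on G and at least
   minus that on H; this passes to weak limits.  Hence the estimator for the
   pair (i, j) has bias at most w i j / 2 on F i, at least - w i j / 2 on F j,
   and standard deviation at most w i j.

   Let N be the largest of the k + k ^ 2 noise terms, each divided by a bound
   on its standard deviation.  If f is in F i0, every zhat i0 j is at most
   2 + 2 N, so the selected index ihat also satisfies zhat ihat i0 <= 2 + 2 N,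
   and comparing That ihat with the pair estimators for (ihat, i0) and
   (i0, ihat) gives |That_star - T f| <= 3 (1 + M) (1 + N) w, where w is the
   modulus of the union.  Since the noise terms are sub-Gaussian,
   E (1 + N) ^ p is of order (ln k) ^ (p / 2).  Finally M >= 1/6, because some
   w i i is positive and the risk of a linear estimator on F i is at least a
   constant times w i i ^ 2; so 1 + M is at most 7 M. *)
Require Import Defs.
From mathcomp Require Import all_boot all_order all_algebra.
From mathcomp Require Import all_classical all_reals all_analysis.
From mathcomp Require Import measurable_realfun ring lra.

Set Implicit Arguments.
Unset Strict Implicit.
Unset Printing Implicit Defensive.

Import Order.TTheory GRing.Theory Num.Theory.
Import numFieldNormedType.Exports.

Local Open Scope classical_set_scope.
Local Open Scope ring_scope.

(** * Inner product and seminorm of square-integrable functions *)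

Section hilbert_facts.
Context d (X : measurableType d) (R : realType) (mu : {measure set X -> \bar R}).
Implicit Types (f g h u v w : L2 mu) (c t e s : R).

Lemma L2_mul_integrable f g :
  mu.-integrable setT (EFin \o (fun x => f x * g x)).
Proof.
by have /Lfun1_integrable := Lfun2_mul_Lfun1 (LfunP f) (LfunP g).
Qed.

Lemma innerC f g : inner f g = inner g f.
Proof. by apply: eq_Rintegral => x _; rewrite mulrC. Qed.

Lemma innerDl f g h : inner (f + g) h = inner f h + inner g h.
Proof.
rewrite /inner -RintegralD//; [|exact: L2_mul_integrable..].
by apply: eq_Rintegral => x _; rewrite /= mulrDl.
Qed.

Lemma innerZl c f g : inner (c *: f) g = c * inner f g.
Proof.
rewrite /inner -RintegralZl//; last exact: L2_mul_integrable.
by apply: eq_Rintegral => x _; rewrite /= mulrA.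
Qed.

Lemma innerDr f g h : inner h (f + g) = inner h f + inner h g.
Proof. by rewrite innerC innerDl !(innerC h). Qed.

Lemma innerZr c f g : inner g (c *: f) = c * inner g f.
Proof. by rewrite innerC innerZl innerC. Qed.

Lemma innerNl f g : inner (- f) g = - inner f g.
Proof. by rewrite -scaleN1r innerZl mulN1r. Qed.

Lemma innerNr f g : inner g (- f) = - inner g f.
Proof. by rewrite innerC innerNl innerC. Qed.

Lemma l2norm_ge0 f : 0 <= l2norm f.
Proof. by rewrite fine_ge0// Lnorm_ge0. Qed.

Lemma l2norm_sqr_int f : ((l2norm f ^+ 2)%:E = \int[mu]_x (f x ^+ 2)%:E)%E.
Proof.
transitivity (((l2norm f)%:E) `^ 2)%E.
  by rewrite poweR_EFin powR_mulrn// l2norm_ge0.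
rewrite (finite_norm_fine f) powR_Lnorm//.
apply: eq_integral => x _.
by rewrite abse_EFin poweR_EFin powR_mulrn// -normrX ger0_norm// sqr_ge0.
Qed.

Lemma inner_self f : inner f f = l2norm f ^+ 2.
Proof.
rewrite /inner /Rintegral -[RHS]/(fine (l2norm f ^+ 2)%:E) l2norm_sqr_int.
by congr fine; apply: eq_integral => x _; rewrite expr2.
Qed.

Lemma inner_abs_le f g : `|inner f g| <= l2norm f * l2norm g.
Proof.
rewrite -lee_fin EFin_normr_Rintegral//; last exact: L2_mul_integrable.
apply: (le_trans (le_abse_integral _ _ _)) => //.
  by case/integrableP: (L2_mul_integrable f g).
rewrite EFinM !finite_norm_fine.
have := @hoelder _ _ _ mu f g 2 2.
rewrite Lnorm1; apply => //; lra.
Qed.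

Lemma inner_le f g : inner f g <= l2norm f * l2norm g.
Proof. exact: le_trans (ler_norm _) (inner_abs_le f g). Qed.

Lemma l2normZ c f : l2norm (c *: f) = `|c| * l2norm f.
Proof.
by apply/EFin_inj; rewrite EFinM !finite_norm_fine -LnormZ.
Qed.

Lemma l2normN f : l2norm (- f) = l2norm f.
Proof. by rewrite -scaleN1r l2normZ normrN1 mul1r. Qed.

Lemma ler_l2normD f g : l2norm (f + g) <= l2norm f + l2norm g.
Proof. exact: ler_LnormD. Qed.

Lemma l2norm_eq0_ae f g : l2norm (g - f) = 0 -> (f : X -> R) = g %[ae mu].
Proof.
move=> /fine_Lnormr_eq0; apply: filterS => x /= /(_ Logic.I)/eqP.
by rewrite /= subr_eq0 => /eqP.
Qed.

Lemma ball_convex_seg r f g t : 0 <= t <= 1 ->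
  l2norm f <= r -> l2norm g <= r -> l2norm (f + t *: (g - f)) <= r.
Proof.
move=> /andP[t0 t1] fr gr.
rewrite (_ : f + _ = (1 - t) *: f + t *: g); last first.
  by rewrite scalerBr scalerBl scale1r addrA addrAC.
rewrite (le_trans (ler_l2normD _ _))// !l2normZ !ger0_norm// ?subr_ge0//.
have -> : r = (1 - t) * r + t * r by ring.
by rewrite lerD// ler_wpM2l// subr_ge0.
Qed.

Lemma l2convex_seg (F : set (L2 mu)) f g t :
  convex_set (F : set (convex_lmodType (L2 mu))) -> 0 <= t <= 1 ->
  F f -> F g -> F (f + t *: (g - f)).
Proof.
move=> cF /andP[t0 t1] Ff Fg.
have := cF g f (Itv01 t0 t1) (mem_set Fg) (mem_set Ff).
rewrite inE => h.
have {}h : F (t *: g + (1 - t) *: f) by exact: h.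
suff -> : f + t *: (g - f) = t *: g + (1 - t) *: f by [].
by rewrite scalerBr scalerBl scale1r addrCA.
Qed.

(* First-order condition at v for the map t |-> |v + t w|, without derivatives:
   |v + t w| <= |v| + t <v, w> / |v| + O(t^2). *)
Lemma norm_first_order v w (s D : R) : 0 < l2norm v -> 0 <= s ->
  (forall t, 0 < t <= 1 -> t * D <= s * (l2norm (v + t *: w) - l2norm v)) ->
  D <= s * inner ((l2norm v)^-1 *: v) w.
Proof.
move=> e0 s0 H; set e := l2norm v in e0 H *.
set K := l2norm w ^+ 2 / (2 * e).
have K0 : 0 <= K by rewrite divr_ge0 ?sqr_ge0// mulr_ge0 ?ltW.
rewrite innerZl; set m := inner v w.
have key t : 0 < t <= 1 -> D <= s * (e^-1 * m) + t * (s * K).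
  move=> t01; have /andP[t0 _] := t01.
  have N : l2norm (v + t *: w) ^+ 2 =
      e ^+ 2 + 2 * t * m + t ^+ 2 * l2norm w ^+ 2.
    rewrite -inner_self !innerDl !innerDr !innerZl !innerZr !inner_self.
    by rewrite (innerC w v) -/m -/e; clearbody e m; ring.
  have B : l2norm (v + t *: w) - e <= t * (e^-1 * m) + t ^+ 2 * K.
    (* For x = |v + t w| the claim becomes x - e <= (x ^ 2 - e ^ 2) / (2 e), that is 0 <= (x - e) ^
       2. *)
    have -> : t * (e^-1 * m) + t ^+ 2 * K =
        (l2norm (v + t *: w) ^+ 2 - e ^+ 2) / (2 * e).
      by rewrite N /K; field; rewrite gt_eqF.
    rewrite ler_pdivlMr ?mulr_gt0//.
    by have := sqr_ge0 (l2norm (v + t *: w) - e); nra.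
  have := le_trans (H t t01) (ler_wpM2l s0 B).
  rewrite [leRHS](_ : _ = t * (s * (e^-1 * m) + t * (s * K))); last first.
    by clearbody K; ring.
  by rewrite ler_pM2l.
apply/ler_addgt0Pl => x x0.
have sK0 : 0 <= s * K by rewrite mulr_ge0.
(* This [t] is at most 1 and makes the remainder [t * (s * K)] at most [x]. *)
pose t := x / (x + s * K + 1).
have d0 : 0 < x + s * K + 1 by lra.
have t0 : 0 < t by rewrite divr_gt0.
have t1 : t <= 1 by rewrite ler_pdivrMr// mul1r; lra.
have := key t; rewrite t0 t1 => /(_ isT) h.
apply: (le_trans h); rewrite addrC lerD2r.
rewrite /t mulrAC ler_pdivrMr// ler_wpM2l//; [exact: ltW|lra].
Qed.

End hilbert_facts.

(** * Modulus of continuity, excess and extremal pairs *)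

Section modulus_facts.
Context d (X : measurableType d) (R : realType) (mu : {measure set X -> \bar R}).
Context (D : set (L2 mu)) (T : L2 mu -> R) (linT : linear_functional_on D T).
Implicit Types (f g h u v w : L2 mu) (F G H : set (L2 mu)) (c t e s r : R).

Let l2convex G := convex_set (G : set (convex_lmodType (L2 mu))).

Lemma functional_seg f g t : D f -> D g ->
  T (f + t *: (g - f)) = T f + t * (T g - T f).
Proof.
move=> Df Dg; have [Dgf Tgf] := linT.1 (-1) f g Df Dg.
have [_] := linT.1 t _ f Dgf Df.
rewrite Tgf !scaleN1r (addrC (- f)) (addrC f) => ->.
ring.
Qed.

Lemma functional_mid f g : D f -> D g ->
  T (2^-1 *: (f + g)) = (T f + T g) / 2.
Proof.
move=> Df Dg; rewrite (_ : _ *: _ = f + 2^-1 *: (g - f)).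
  by rewrite functional_seg//; field.
rewrite scalerBr scalerDr [in RHS]addrCA addrC; congr (_ + _).
apply/eqP; rewrite eq_sym subr_eq -scalerDl.
by rewrite -{1}(scale1r f); apply/eqP; congr (_ *: _); field.
Qed.

(** As [l2norm] is only a seminorm, a pair at distance 0 may consist of different functions; here
    the almost-everywhere invariance of [T] enters. *)
Lemma functional_null f g : D f -> D g -> l2norm (g - f) = 0 -> T f = T g.
Proof. by move=> Df Dg /l2norm_eq0_ae; exact: linT.2. Qed.

Lemma modulus_ub e G H f g : G f -> H g -> l2norm (g - f) <= e ->
  ((T g - T f)%:E <= modulus T e G H)%E.
Proof. by move=> Gf Hg gfe; apply: ereal_sup_ubound; exists f, g; split. Qed.

Lemma modulus_ge0 e G H : 0 <= e -> G `&` H !=set0 ->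
  (0 <= modulus T e G H)%E.
Proof.
move=> e0 [h [Gh Hh]]; have := @modulus_ub e G H h h Gh Hh.
by rewrite !subrr; apply; rewrite -(scale0r 0) l2normZ normr0 mul0r.
Qed.

Lemma le_modulus e G H G' H' : G `<=` G' -> H `<=` H' ->
  (modulus T e G H <= modulus T e G' H')%E.
Proof.
move=> GG HH; apply: ub_ereal_sup => _ [f [g [Gf Hg fge ->]]].
by apply: modulus_ub => //; [exact: GG|exact: HH].
Qed.

Lemma l2norm_seg f g f' g' t : 0 <= t ->
  g' - f' = t *: (g - f) -> l2norm (g' - f') = t * l2norm (g - f).
Proof. by move=> t0 ->; rewrite l2normZ ger0_norm. Qed.

(* Contracting towards a common point of G and H keeps a pair in G x H. *)
Lemma modulus_shrink G H f g t e : l2convex G -> l2convex H ->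
  G `<=` D -> H `<=` D -> G `&` H !=set0 -> G f -> H g ->
  0 <= t <= 1 -> t * l2norm (g - f) <= e ->
  ((t * (T g - T f))%:E <= modulus T e G H)%E.
Proof.
move=> cG cH GD HD [h [Gh Hh]] Gf Hg t01 te; have /andP[t0 _] := t01.
have -> : t * (T g - T f) = T (h + t *: (g - h)) - T (h + t *: (f - h)).
  rewrite !functional_seg; [ring|exact: HD|exact: GD|exact: HD|exact: HD].
apply: modulus_ub; [exact: l2convex_seg|exact: l2convex_seg|].
rewrite (l2norm_seg t0 (_ : _ = t *: (g - f)))//.
by rewrite opprD addrACA subrr add0r -scalerBr opprB addrA subrK.
Qed.

Section rated.
Context (n : nat) (n_gt0 : (0 < n)%N).

Let sqrtn_gt0 : 0 < Num.sqrt n%:R :> R.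
Proof. by rewrite sqrtr_gt0 ltr0n. Qed.

Lemma rate_gt0 : 0 < rate R n.
Proof. by rewrite invr_gt0. Qed.

Lemma sqrt_rate (x : R) : 0 <= x -> Num.sqrt (n%:R * x ^+ 2) * rate R n = x.
Proof.
move=> x0; rewrite sqrtrM// sqrtr_sqr ger0_norm// /rate.
by rewrite mulrAC divff ?mul1r// gt_eqF.
Qed.

(** This lemma and the next trade a bound on a supremum of extended reals for linear inequalities
    between reals, one for each pair. *)
Lemma excess_half_sup_ge G H V b f g e : 0 < e ->
  (excess_half_sup T n V G H <= b%:E)%E -> G f -> H g -> l2norm (g - f) <= e ->
  T g - T f - Num.sqrt (n%:R * V) * e <= 2 * b.
Proof.
move=> e0 hb Gf Hg fge.
have h : (((T g - T f) - Num.sqrt (n%:R * V) * e)%:E <= ereal_sup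
    [set excess T n V G H e0 | e0 in [set e0 : R | (0 < e0)%R]])%E.
  apply: (@le_trans _ _ (excess T n V G H e)).
    by rewrite EFinB leeB// modulus_ub.
  by apply: ereal_sup_ubound; exists e.
have k0 : (0 <= (2^-1 : R)%:E)%E by rewrite lee_fin invr_ge0.
by have := le_trans (lee_wpmul2l k0 h) hb; rewrite -EFinM lee_fin; lra.
Qed.

Lemma excess_half_sup_le G H V b : (forall f g e, 0 < e -> G f -> H g ->
    l2norm (g - f) <= e -> T g - T f <= 2 * b + Num.sqrt (n%:R * V) * e) ->
  (excess_half_sup T n V G H <= b%:E)%E.
Proof.
move=> h; rewrite /excess_half_sup.
have -> : b%:E = (2^-1%:E * (2 * b)%:E)%E by rewrite -EFinM mulKf.
apply: lee_wpmul2l; first by rewrite lee_fin invr_ge0.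
apply: ub_ereal_sup => _ [e /= e0 <-].
rewrite /excess leeBlDr// -EFinD; apply: ub_ereal_sup => _ [f [g [Gf Hg ge ->]]].
by rewrite lee_fin; exact: h.
Qed.

Lemma le_excess_half_sup G H G' H' V : G `<=` G' -> H `<=` H' ->
  (excess_half_sup T n V G H <= excess_half_sup T n V G' H')%E.
Proof.
move=> GG HH; apply: lee_wpmul2l; first by rewrite lee_fin invr_ge0.
apply: ub_ereal_sup => _ [e /= e0 <-].
apply: (@le_trans _ _ (excess T n V G' H' e)); first by rewrite leeB// le_modulus.
by apply: ereal_sup_ubound; exists e.
Qed.

(** For this variance the slope is w / [rate R n], with w the modulus at the rate. Up to the rate
    the modulus is at most w; beyond it, shrinking a pair to the rate shows that the modulus is at
    most slope times distance. So the excess never exceeds w. *)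
Lemma excess_half_sup_variance G H : l2convex G -> l2convex H ->
  G `<=` D -> H `<=` D -> G `&` H !=set0 ->
  (modulus T (rate R n) G H < +oo)%E ->
  (excess_half_sup T n (pair_variance T n G H) G H <=
    (fine (modulus T (rate R n) G H) / 2)%:E)%E.
Proof.
move=> cG cH GD HD GH fin; have r0 := rate_gt0.
have w0 := modulus_ge0 (ltW r0) GH.
have wE : modulus T (rate R n) G H = (fine (modulus T (rate R n) G H))%:E.
  by rewrite fineK// ge0_fin_numE.
rewrite /pair_variance; set w := fine _ in wE *.
have {}w0 : 0 <= w by rewrite fine_ge0.
apply: excess_half_sup_le => f g e e0 Gf Hg fge.
have [er|re] := leP e (rate R n).
  have := modulus_ub Gf Hg (le_trans fge er); rewrite wE lee_fin => h.
  by apply: (le_trans h); rewrite mulrC divfK// lerDl mulr_ge0 ?sqrtr_ge0// ltW.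
have t01 : 0 <= rate R n / e <= 1.
  apply/andP; split; first by rewrite divr_ge0// ltW.
  by rewrite ler_pdivrMr// mul1r ltW.
have := modulus_shrink cG cH GD HD GH Gf Hg t01.
move=> /(_ (rate R n)); rewrite wE lee_fin => /(_ _) h.
have {h} : rate R n / e * (T g - T f) <= w.
  by apply: h; rewrite mulrAC ler_pdivrMr// ler_wpM2l// ltW.
rewrite mulrAC ler_pdivrMr// => h.
have {h} : T g - T f <= Num.sqrt (n%:R * w ^+ 2) * e.
  rewrite -(ler_pM2l r0); apply: (le_trans h).
  by rewrite mulrA (mulrC (rate _ _)) sqrt_rate.
by move/le_trans; apply; rewrite lerDr mulr_ge0// divr_ge0.
Qed.

(** At distance 0 both points have the same value of [T], so a maximal excess attained there would
    be 0 and the half supremum could not be positive. In the degenerate case the linear piece has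
    positive length. *)
Lemma extremal_pair_gt0 V G H e f g : G `<=` D -> H `<=` D ->
  extremal_pair T n V G H e f g -> 0 < e.
Proof.
move=> GD HD [+ Gf Hg ge Te].
have e0 : 0 <= e by rewrite -ge l2norm_ge0.
case=> [[/andP[B0 _] [_ emax] _]|[_ _ [e1 e1_gt0 lin] _ emax]]; last first.
  have r0 := rate_gt0; pose e2 := Num.min e1 (rate R n).
  have e2_gt0 : 0 < e2 by rewrite lt_min e1_gt0.
  apply: (lt_le_trans e2_gt0); apply: emax.
    by rewrite (ltW e2_gt0) ge_min lexx orbT.
  by apply: lin; rewrite (ltW e2_gt0) ge_min lexx.
rewrite lt_neqAle e0 andbT; apply/negP => /eqP e00; move: B0; apply/negP.
rewrite -leNgt; apply: excess_half_sup_le => f' g' e' e'0 Gf' Hg' ge'.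
have := emax e' (ltW e'0).
rewrite /excess -Te -e00 mulr0 sube0 (functional_null (GD _ Gf) (HD _ Hg)); last first.
  by rewrite ge.
rewrite subrr leeBlDr// add0e => h; rewrite mulr0 add0r -lee_fin.
exact: le_trans (modulus_ub Gf' Hg' ge') h.
Qed.

(** Removes the modulus: the pair maximizes an explicit function on [G] x [H], to which a
    first-order condition applies. In the degenerate case the maximum is 0. *)
Lemma extremal_pair_max V G H e f g f' g' : G `<=` D -> H `<=` D ->
  extremal_pair T n V G H e f g -> G f' -> H g' ->
  T g' - T f' - Num.sqrt (n%:R * V) * l2norm (g' - f') <=
  T g - T f - Num.sqrt (n%:R * V) * l2norm (g - f).
Proof.
move=> GD HD [+ Gf Hg -> Te] Gf' Hg'.
set s := Num.sqrt _; set e' := l2norm (g' - f').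
have e'0 : 0 <= e' by exact: l2norm_ge0.
case=> [[_ [_ emax] _]|[B0 _ _ [_ lin] _]].
  have := emax e' e'0; rewrite -lee_fin /excess -Te -EFinB.
  by apply: le_trans; rewrite EFinB leeB// modulus_ub.
have -> : T g - T f - s * e = 0.
  by apply/EFin_inj; rewrite EFinB Te lin -/s subee.
(* The half supremum ranges over positive distances only, so distance 0 is treated apart. *)
move: e'0; rewrite le_eqVlt => /predU1P[e'0|e'0].
  by rewrite -e'0 mulr0 subr0 (functional_null (GD _ Gf') (HD _ Hg')) ?subrr.
have := @excess_half_sup_ge G H V 0 f' g' e' e'0.
by rewrite mulr0; apply => //; rewrite B0.
Qed.

(** The intercept, taken at the midpoint, makes the biases at [f] and [g] opposite: plus and minus
    half of [T g - T f - s * e], with [s] the slope. The first-order condition in each argument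
    separately shows that the bias is largest on [G] at [f] and smallest on [H] at [g]. *)
Lemma extremal_pair_bias V b G H e f g : l2convex G -> l2convex H ->
  G `<=` D -> H `<=` D -> extremal_pair T n V G H e f g ->
  (excess_half_sup T n V G H <= b%:E)%E ->
  [/\ l2norm (direction e f g) = 1,
      forall f', G f' -> intercept T n V e f g +
        Num.sqrt (n%:R * V) * inner (direction e f g) f' - T f' <= b &
      forall g', H g' -> - b <= intercept T n V e f g +
        Num.sqrt (n%:R * V) * inner (direction e f g) g' - T g'].
Proof.
move=> cG cH GD HD ext hb; have e0 := extremal_pair_gt0 GD HD ext.
have [_ Gf Hg ge _] := ext.
have hmax f' g' := @extremal_pair_max V G H e f g f' g' GD HD ext.
have Df := GD _ Gf; have Dg := HD _ Hg.
rewrite /intercept functional_mid//.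
set s := Num.sqrt _; have s0 : 0 <= s by exact: sqrtr_ge0.
have h2b := excess_half_sup_ge e0 hb Gf Hg (eq_ind _ (fun x => x <= e) (lexx e) _ (esym ge)).
rewrite -/s in h2b hmax.
have uE : direction e f g = (l2norm (g - f))^-1 *: (g - f) by rewrite ge.
have inner_u x : inner (direction e f g) x = e^-1 * inner (g - f) x.
  by rewrite innerZl.
have ugf : inner (direction e f g) (g - f) = e.
  by rewrite inner_u inner_self ge expr2 mulKf// gt_eqF.
have {}ugf : inner (direction e f g) g = e + inner (direction e f g) f.
  by move: ugf; rewrite innerDr innerNr; lra.
have mid : inner (direction e f g) (2^-1 *: (f + g)) =
    inner (direction e f g) f + e / 2.
  by rewrite innerZr innerDr ugf; field.
rewrite mid; split.
- by rewrite uE l2normZ ge ger0_norm ?invr_ge0 ?ltW// mulVf// gt_eqF.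
- move=> f' Gf'; have Df' := GD _ Gf'.
  suff : T f - T f' <= s * inner (direction e f g) (f - f').
    rewrite innerDr innerNr; lra.
  rewrite uE; apply: norm_first_order => //; first by rewrite ge.
  move=> t /andP[t0 t1].
  have t01 : 0 <= t <= 1 by rewrite (ltW t0).
  have := hmax _ g (l2convex_seg cG t01 Gf Gf') Hg.
  rewrite functional_seg//.
  have -> : g - (f + t *: (f' - f)) = g - f + t *: (f - f').
    by rewrite opprD addrA -scalerN opprB.
  lra.
- move=> g' Hg'; have Dg' := HD _ Hg'.
  suff : T g' - T g <= s * inner (direction e f g) (g' - g).
    rewrite innerDr innerNr ugf; lra.
  rewrite uE; apply: norm_first_order => //; first by rewrite ge.
  move=> t /andP[t0 t1].
  have t01 : 0 <= t <= 1 by rewrite (ltW t0).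
  have := hmax f _ Gf (l2convex_seg cH t01 Hg Hg').
  rewrite functional_seg//.
  have -> : g + t *: (g' - g) - f = g - f + t *: (g' - g) by rewrite addrAC.
  lra.
Qed.

End rated.
End modulus_facts.

(** * Bias of the estimator attached to a pair of sets *)

Lemma near_subseq (phi : nat -> nat) (Q : nat -> Prop) : increasing_seq phi ->
  (\forall m \near \oo, Q m) -> \forall j \near \oo, Q (phi j).
Proof.
move=> incphi [N _ QN]; exists N => // j /= Nj; apply: QN => /=.
apply: (leq_trans Nj); elim: (j) => // i ih; apply: (leq_ltn_trans ih).
by rewrite (leqW_mono incphi).
Qed.

Section pair_estimator.
Context d (X : measurableType d) (R : realType) (mu : {measure set X -> \bar R}).
Context (D : set (L2 mu)) (T : L2 mu -> R) (linT : linear_functional_on D T).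
Context (n : nat) (n_gt0 : (0 < n)%N).
Context (G H : set (L2 mu)).
Hypotheses (convG : convex_set (G : set (convex_lmodType (L2 mu))))
  (convH : convex_set (H : set (convex_lmodType (L2 mu)))).
Hypotheses (GD : G `<=` D) (HD : H `<=` D) (GH : G `&` H !=set0).
Hypothesis modulus_fin : (modulus T (rate R n) G H < +oo)%E.

Local Notation w := (fine (modulus T (rate R n) G H)).
Local Notation V := (pair_variance T n G H).
Local Notation slope V := (Num.sqrt (n%:R * V)).

Let r_gt0 : 0 < rate R n. Proof. exact: rate_gt0. Qed.

Lemma modulus_rateE : modulus T (rate R n) G H = w%:E.
Proof.
by rewrite fineK// ge0_fin_numE// (modulus_ge0 _ (ltW r_gt0)).
Qed.

Lemma modulus_rate_ge0 : 0 <= w.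
Proof. by rewrite fine_ge0// (modulus_ge0 _ (ltW r_gt0)). Qed.

Lemma slope_rate : slope V * rate R n = w.
Proof. by rewrite sqrt_rate// modulus_rate_ge0. Qed.

(** Contracting such a pair to distance at most [rate R n] keeps the gain in [T] positive. This
    carries positivity of the modulus from radius 1 to the rate. *)
Lemma modulus_rate_gt0 f g : G f -> H g -> T f < T g -> 0 < w.
Proof.
move=> Gf Hg Tfg; pose t := Num.min 1 (rate R n / (l2norm (g - f) + 1)).
have N0 : 0 < l2norm (g - f) + 1 by have := l2norm_ge0 (g - f); lra.
have t_gt0 : 0 < t by rewrite lt_min ltr01 divr_gt0.
have t01 : 0 <= t <= 1 by rewrite (ltW t_gt0) ge_min lexx.
have tr : t * l2norm (g - f) <= rate R n.
  apply: (@le_trans _ _ (t * (l2norm (g - f) + 1))).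
    by rewrite ler_wpM2l ?(ltW t_gt0)//; lra.
  by rewrite -ler_pdivlMr// ge_min lexx orbT.
have := modulus_shrink linT convG convH GD HD GH Gf Hg t01 tr.
rewrite modulus_rateE lee_fin; apply: lt_le_trans.
by rewrite mulr_gt0// subr_gt0.
Qed.

(** A common point of [G] and [H] gives an excess of at least minus slope times [e], which tends to
    0 with [e]. So the half supremum is either 0 or positive, the two cases of the construction. *)
Lemma excess_half_sup_ge0 : (0 <= excess_half_sup T n V G H)%E.
Proof.
rewrite leNgt; apply/negP => neg.
have [b b0 hb] : exists2 b : R, b < 0 & (excess_half_sup T n V G H <= b%:E)%E.
  move: neg; case: (excess_half_sup T n V G H) => [x x0||]//.
    by exists x.
  by exists (-1) => //; rewrite leNye.
have [h [Gh Hh]] := GH; have s0 := sqrtr_ge0 (n%:R * V).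
pose e := - b / (slope V + 1).
have s1 : 0 < slope V + 1 by lra.
have e0 : 0 < e by rewrite divr_gt0// oppr_gt0.
have := excess_half_sup_ge e0 hb Gh Hh.
rewrite !subrr -(scale0r 0) l2normZ normr0 mul0r => /(_ (ltW e0)).
have : slope V * e <= - b.
  by rewrite /e mulrA ler_pdivrMr// mulrC ler_wpM2l// ?oppr_ge0 ?ltW//; lra.
lra.
Qed.

Local Notation Gm m := (G `&` l2ball m%:R).
Local Notation Hm m := (H `&` l2ball m%:R).

Let ball_convex F r : convex_set (F : set (convex_lmodType (L2 mu))) ->
  convex_set (F `&` l2ball r : set (convex_lmodType (L2 mu))).
Proof.
move=> cF x y l; rewrite !inE => -[Fx bx] [Fy b_y]; split.
  by have := cF x y l (mem_set Fx) (mem_set Fy); rewrite inE.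
have l01 : 0 <= l%:num <= 1 by rewrite ge0 le1.
have := ball_convex_seg l01 b_y bx.
rewrite (_ : y + _ = l%:num *: x + (1 - l%:num) *: y) => [//|].
by rewrite scalerBr scalerBl scale1r addrCA.
Qed.

Let near_ball (F : set (L2 mu)) f : F f ->
  \forall m \near \oo, (F `&` l2ball m%:R) f.
Proof.
by move=> Ff; near=> m; split => //; near: m; exact: nbhs_infty_ger.
Unshelve. all: by end_near. Qed.

Let near_small e : 0 < e -> \forall m \near \oo, (m%:R^-1 : R) <= e.
Proof.
move=> e0; near=> m; rewrite -[leRHS]invrK lef_pV2 ?posrE ?invr_gt0//.
  by near: m; exact: nbhs_infty_ger.
by rewrite ltr0n; near: m; exact: nbhs_infty_gt.
Unshelve. all: by end_near. Qed.

(** Only the degenerate case needs an argument. A pair with [T g - T f] above [w - x] lies in the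
    truncated sets for large m, and the small half supremum there gives
    [w - x - slope (Vm m) * rate R n] at most 2 / m. Since [slope V * rate R n] is [w], the slopes
    are close. *)
Let slope_cvg (Vm : R^nat) : 0 < w ->
  ((0 < excess_half_sup T n V G H)%E -> forall m, Vm m = V) ->
  (excess_half_sup T n V G H = 0%E -> \forall m \near \oo,
     0 <= Vm m < V /\
     (0 < excess_half_sup T n (Vm m) (Gm m) (Hm m) <= (m%:R^-1)%:E)%E) ->
  slope (Vm m) @[m --> \oo] --> slope V.
Proof.
move=> w0 Vpos V0; have := excess_half_sup_ge0.
rewrite le_eqVlt => /predU1P[/esym/V0{V0}Vz|/Vpos{}Vpos]; last first.
  by under eq_fun do rewrite Vpos; exact: cvg_cst.
apply/cvgrPdist_le => e e0; pose x := e * rate R n / 2.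
have x0 : 0 < x by rewrite divr_gt0// mulr_gt0.
have : ((w - x)%:E < modulus T (rate R n) G H)%E.
  by rewrite modulus_rateE lte_fin; lra.
case/ereal_sup_gt => _ [f [g [Gf Hg fgr ->]]]; rewrite lte_fin => Tfg.
near=> m.
have [/andP[Vm0 VmV] /andP[_ hB]] : 0 <= Vm m < V /\
  (0 < excess_half_sup T n (Vm m) (Gm m) (Hm m) <= (m%:R^-1)%:E)%E.
  by near: m.
have mx : (m%:R^-1 : R) <= x / 2 by near: m; apply: near_small; rewrite divr_gt0.
have Gmf : (Gm m) f by near: m; exact: near_ball.
have Hmg : (Hm m) g by near: m; exact: near_ball.
have h := excess_half_sup_ge r_gt0 hB Gmf Hmg fgr.
have sm : slope (Vm m) <= slope V.
  by rewrite ler_wsqrtr// ler_wpM2l// ltW.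
rewrite ger0_norm ?subr_ge0// -(ler_pM2r r_gt0) mulrBl slope_rate.
by move: h mx Tfg; rewrite /x; lra.
Unshelve. all: by end_near. Qed.

Lemma pair_coefs_bias a u : (0 < modulus T 1 G H)%E ->
  pair_coefs T n G H a u ->
  [/\ l2norm u <= 1,
      forall f, G f -> a + slope V * inner u f - T f <= w / 2 &
      forall g, H g -> - (w / 2) <= a + slope V * inner u g - T g].
Proof.
case/ereal_sup_gt => _ [f0 [g0 [Gf0 Hg0 _ ->]]]; rewrite lte_fin subr_gt0.
move/(modulus_rate_gt0 Gf0 Hg0) => w0.
have hB : (excess_half_sup T n V G H <= (w / 2)%:E)%E.
  exact: (excess_half_sup_variance linT).
case=> [[e [f [g [ext -> ->]]]]|[_ [Vm [em [fm [gm [phi]]]]]] /=].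
  have [u1 bG bH] := extremal_pair_bias linT n_gt0 convG convH GD HD ext hB.
  by rewrite u1; split.
case=> Vpos V0 ext incphi [ucvg acvg].
have scvg : slope (Vm m) @[m --> \oo] --> slope V by exact: slope_cvg.
have {}scvg : slope (Vm (phi j)) @[j --> \oo] --> slope V.
  apply/cvgrPdist_le => x x0; have /cvgrPdist_le/(_ x x0) := scvg.
  exact: (near_subseq (Q := fun m => `|slope V - slope (Vm m)| <= x)).
pose um m := direction (em m) (fm m) (gm m).
pose am m := intercept T n (Vm m) (em m) (fm m) (gm m).
have bias : \forall m \near \oo, [/\ l2norm (um m) = 1,
    forall f, Gm m f -> am m + slope (Vm m) * inner (um m) f - T f <= w / 2 &
    forall g, Hm m g -> - (w / 2) <= am m + slope (Vm m) * inner (um m) g - T g].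
  (* In the degenerate case 1 / m falls below [w / 2]; otherwise [Vm m] is [V], and truncating the
     sets can only lower the excess. *)
  have hBm : \forall m \near \oo,
      (excess_half_sup T n (Vm m) (Gm m) (Hm m) <= (w / 2)%:E)%E.
    have := excess_half_sup_ge0; rewrite le_eqVlt => /predU1P[/esym/V0 Vz|/Vpos VE].
      have : \forall m \near \oo, (m%:R^-1 : R) <= w / 2.
        by apply: near_small; rewrite divr_gt0.
      apply: filterS2 Vz => m [_ /andP[_ h]] mw.
      by apply: (le_trans h); rewrite lee_fin.
    near=> m; rewrite VE; apply: le_trans hB.
    by apply: le_excess_half_sup; exact: subIsetl.
  near=> m; apply: (extremal_pair_bias linT n_gt0).
  - exact: ball_convex.
  - exact: ball_convex.
  - by move=> x [/GD].
  - by move=> x [/HD].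
  - by near: m.
  - by near: m.
have {bias} bias := near_subseq incphi bias.
have est f : am (phi j) + slope (Vm (phi j)) * inner (um (phi j)) f - T f
    @[j --> \oo] --> a + slope V * inner u f - T f.
  apply: cvgB; last exact: cvg_cst.
  by apply: cvgD => //; apply: cvgM => //; exact: ucvg.
split.
(* Weak lower semicontinuity of the norm: the weak convergence is tested against [u] itself, with
   which unit vectors pair to at most [l2norm u]. *)
- have : l2norm u ^+ 2 <= l2norm u.
    rewrite -inner_self; apply: (cvgr_to_le (ucvg u)).
    apply: filterS bias => j [u1 _ _].
    by rewrite (le_trans (inner_le _ _))// u1 mul1r.
  have := l2norm_ge0 u; rewrite le_eqVlt => /predU1P[<-//|u0].
  by rewrite expr2 ger_pMr.
(* A fixed point lies in every large ball, so the truncation disappears in the limit. *)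
- move=> f Gf; apply: (cvgr_to_le (est f)).
  have := near_subseq incphi (near_ball Gf).
  by apply: filterS2 bias => j [_ + _]; exact.
- move=> g Hg; apply: (cvgr_to_ge (est g)).
  have := near_subseq incphi (near_ball Hg).
  by apply: filterS2 bias => j [_ _ +]; exact.
Unshelve. all: by end_near. Qed.

End pair_estimator.

(** * Integrals determined by their values on indicators *)

Section weighted_integral.
Import HBNNSimple.
Context d dS (Y : measurableType d) (S : measurableType dS) (R : realType).
Context (mu : {measure set Y -> \bar R}) (G : Y -> R) (Z : Y -> S).
Hypotheses (mG : measurable_fun setT G) (G0 : forall y, 0 <= G y).
Hypothesis mZ : measurable_fun setT Z.

Lemma weighted_integral_nnsfun (h : {nnsfun S >-> R}) :
  (\int[mu]_y (G y * h (Z y))%:E = \sum_(r \in range h)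
     (r%:E * \int[mu]_y (G y * \1_(h @^-1` [set r]) (Z y))%:E))%E.
Proof.
have mind r : measurable_fun setT (fun y => G y * \1_(h @^-1` [set r]) (Z y)).
  apply: measurable_funM => //; apply: measurableT_comp => //.
transitivity (\int[mu]_y \sum_(r \in range h)
    (r%:E * (G y * \1_(h @^-1` [set r]) (Z y))%:E))%E.
  apply: eq_integral => y _.
  rewrite [in LHS](fimfunE h) !fsbig_finite//= mulr_sumr -sumEFin.
  by apply: eq_bigr => r _; rewrite -EFinM mulrCA.
rewrite ge0_integral_fsum//.
- apply: eq_fsbigr => r; rewrite inE => -[x _ <-].
  rewrite ge0_integralZl_EFin//; last exact/measurable_EFinP.
  by move=> y _; rewrite lee_fin mulr_ge0.
- by move=> r; apply: measurable_funeM; exact/measurable_EFinP.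
- move=> r y _; rewrite -EFinM mulrCA lee_fin mulr_ge0//.
  by have := nnfun_muleindic_ge0 h r (Z y); rewrite -EFinM lee_fin.
Qed.

Lemma weighted_integral_lim (g : S -> R) (mg : measurable_fun setT (EFin \o g)) :
  (forall x, 0 <= g x) ->
  (\int[mu]_y (G y * g (Z y))%:E = limn (fun n =>
     \int[mu]_y (G y * nnsfun_approx measurableT mg n (Z y))%:E))%E.
Proof.
move=> g0; rewrite -monotone_convergence//.
- apply: eq_integral => y _; apply/esym/cvg_lim => //.
  rewrite EFinM; under eq_fun do rewrite EFinM.
  apply: cvgeZl => //.
  by apply: (cvg_nnsfun_approx measurableT mg) => // x _; rewrite lee_fin.
- by move=> n; apply/measurable_EFinP/measurable_funM => //; exact: measurableT_comp.
- by move=> n y _; rewrite lee_fin mulr_ge0.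
- move=> y _ a b ab; rewrite lee_fin ler_wpM2l//.
  exact/lefP/nd_nnsfun_approx.
Qed.

End weighted_integral.

Section weighted_integral_unique.
Import HBNNSimple.

(** Simple functions and monotone convergence extend the equality from indicators. With arbitrary
    weights and maps on both sides, the statement serves for restricted measures, for laws with a
    density and for factorization under independence. *)
Lemma eq_weighted_integral d1 d2 dS (Y1 : measurableType d1)
    (Y2 : measurableType d2) (S : measurableType dS) (R : realType)
    (mu1 : {measure set Y1 -> \bar R}) (mu2 : {measure set Y2 -> \bar R})
    (G1 : Y1 -> R) (G2 : Y2 -> R) (Z1 : Y1 -> S) (Z2 : Y2 -> S) :
  measurable_fun setT G1 -> (forall y, 0 <= G1 y) -> measurable_fun setT Z1 ->
  measurable_fun setT G2 -> (forall y, 0 <= G2 y) -> measurable_fun setT Z2 ->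
  (forall B, measurable B -> \int[mu1]_y (G1 y * \1_B (Z1 y))%:E =
                             \int[mu2]_y (G2 y * \1_B (Z2 y))%:E)%E ->
  forall g : S -> R, measurable_fun setT g -> (forall x, 0 <= g x) ->
  (\int[mu1]_y (G1 y * g (Z1 y))%:E = \int[mu2]_y (G2 y * g (Z2 y))%:E)%E.
Proof.
move=> mG1 G10 mZ1 mG2 G20 mZ2 h g mg0 g0.
have mg : measurable_fun setT (EFin \o g) by exact/measurable_EFinP.
rewrite (weighted_integral_lim mu1 mG1 G10 mZ1 mg)//.
rewrite (weighted_integral_lim mu2 mG2 G20 mZ2 mg)//.
congr (limn _); apply/funext => n.
rewrite !weighted_integral_nnsfun//.
by apply: eq_fsbigr => r _; rewrite h//.
Qed.

End weighted_integral_unique.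

Lemma integral_mrestr d (Y : measurableType d) (R : realType)
    (mu : {measure set Y -> \bar R}) (D : set Y) (mD : measurable D)
    (g : Y -> R) : measurable_fun setT g -> (forall x, 0 <= g x) ->
  (\int[mrestr mu mD]_y (g y)%:E = \int[mu]_(y in D) (g y)%:E)%E.
Proof.
move=> mg g0.
transitivity (\int[mrestr mu mD]_y (1 * g y)%:E)%E.
  by apply: eq_integral => y _; rewrite mul1r.
(* The restricted measure has density [\1_D] with respect to [mu]. *)
have /= -> // := @eq_weighted_integral _ _ _ Y Y Y R (mrestr mu mD) mu
  (cst 1) \1_D id id.
- rewrite [RHS]integral_mkcond; apply: eq_integral => y _.
  rewrite patchE indicE; case: ifPn => yD; first by rewrite mul1r.
  by rewrite mul0r.
- move=> B mB; transitivity (\int[mrestr mu mD]_y (\1_B y)%:E)%E.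
    by apply: eq_integral => y _; rewrite mul1r.
  rewrite integral_indic// setIT.
  transitivity (\int[mu]_y (\1_(D `&` B) y)%:E)%E.
    by rewrite integral_indic//; [rewrite setIT setIC|exact: measurableI].
  by apply: eq_integral => y _; rewrite indicI.
Qed.

(** * Expectation of a product of independent factors *)

Section independence.
Context dO (Omega : measurableType dO) (R : realType) (P : probability Omega R).

Lemma expectation_prod (D : set nat) (Z : nat -> Omega -> R) (s : seq nat)
    (f : nat -> R -> R) :
  mutually_independent P D Z -> (forall i, D i -> measurable_fun setT (Z i)) ->
  uniq s -> [set` s] `<=` D ->
  (forall i, measurable_fun setT (f i)) -> (forall i x, 0 <= f i x) ->
  (forall i, D i -> (\int[P]_w (f i (Z i w))%:E)%E \is a fin_num) ->
  (\int[P]_w (\prod_(i <- s) f i (Z i w))%:E =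
   \prod_(i <- s) \int[P]_w (f i (Z i w))%:E)%E.
Proof.
move=> indep mZ us sD mf f0 ffin.
(* The generalized claim mixes functions on [s1] with indicators on [s2]. For empty [s1] it is
   independence of events, and the induction turns one indicator at a time into a function. *)
suff gen s1 s2 (A : nat -> set R) : (forall i, measurable (A i)) ->
    uniq (s1 ++ s2) -> [set` s1 ++ s2] `<=` D ->
    (\int[P]_w ((\prod_(i <- s1) f i (Z i w)) *
       (\prod_(i <- s2) \1_(A i) (Z i w)))%:E =
    (\prod_(i <- s1) \int[P]_w (f i (Z i w))%:E) *
     (\prod_(i <- s2) P (Z i @^-1` A i)))%E.
  have := gen s [::] (fun=> setT); rewrite cats0 big_nil mule1 => <-//.
  by apply: eq_integral => w _; rewrite big_nil mulr1.
elim: s1 s2 A => [|i s1 ih] s2 A mA.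
  rewrite cat0s big_nil mul1e => us2 s2D; rewrite -indep//.
  transitivity (\int[P]_w (\1_(\bigcap_(i in [set` s2]) (Z i @^-1` A i)) w)%:E)%E.
    apply: eq_integral => w _; rewrite big_nil mul1r; congr EFin.
    elim: (s2) => [|j s3 ih].
      by rewrite big_nil classical_sets.set_nil bigcap_set0 indicT.
    have -> : [set` j :: s3] = j |` [set` s3].
      by apply/predeqP => x /=; rewrite inE; split=> /predU1P.
    by rewrite big_cons ih bigcap_setU1 indicI.
  rewrite integral_indic ?setIT//; apply: fin_bigcap_measurable => // j js2.
  by rewrite -[_ @^-1` _]setTI; apply: mZ => //; exact: s2D.
move=> /= us' sD'.
have us1 : uniq (s1 ++ i :: s2) by rewrite -cat1s uniq_catCA.
have sE : [set` s1 ++ i :: s2] `<=` D.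
  move=> j; rewrite /= -cat1s mem_cat mem_cat orbCA -!mem_cat => h.
  by apply: sD'.
have Di : D i by apply: sD'; rewrite /= mem_head.
have nis2 : i \notin s2.
  by move: us' => /andP[]; rewrite mem_cat negb_or => /andP[].
pose G w := (\prod_(j <- s1) f j (Z j w)) * \prod_(j <- s2) \1_(A j) (Z j w).
have G0 w : 0 <= G w by rewrite mulr_ge0// prodr_ge0.
have mG : measurable_fun setT G.
  have sub j : j \in s1 ++ s2 -> D j.
    by move=> js; apply: sD'; rewrite /= inE js orbT.
  apply: measurable_funM; apply: measurable_prod => j js.
    by apply: measurableT_comp => //; apply/mZ/sub; rewrite mem_cat js.
  apply: measurableT_comp => //; apply/mZ/sub; rewrite mem_cat js orbT//.
have PA j : j \in s2 -> P (Z j @^-1` A j) \is a fin_num.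
  move=> js; apply: fin_num_measure.
  rewrite -[_ @^-1` _]setTI; apply: mZ => //.
  by apply: sD'; rewrite /= inE mem_cat js !orbT.
pose c := ((\prod_(j <- s1) \int[P]_w (f j (Z j w))%:E) *
           (\prod_(j <- s2) P (Z j @^-1` A j)))%E.
have cfin : c \is a fin_num.
  rewrite fin_numM//; rewrite big_seq; apply: prode_fin_num => j js.
    by apply: ffin; apply: sD'; rewrite /= inE mem_cat js orbT.
  exact: PA.
have c0 : 0 <= fine c.
  rewrite fine_ge0// mule_ge0// prode_ge0// => j _.
  by apply: integral_ge0 => w _; rewrite lee_fin.
have cZ (g : R -> R) : measurable_fun setT g -> (forall x, 0 <= g x) ->
    (\int[P]_w (fine c * g (Z i w))%:E = c * \int[P]_w (g (Z i w))%:E)%E.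
  move=> mg g0; rewrite -[in RHS](fineK cfin) -ge0_integralZl_EFin//.
  - by move=> w _; rewrite lee_fin.
  - by apply/measurable_EFinP; apply: measurableT_comp => //; exact: mZ.
transitivity (\int[P]_w (G w * f i (Z i w))%:E)%E.
  by apply: eq_integral => w _; rewrite big_cons /G -mulrA [in LHS]mulrC.
transitivity (\int[P]_w (fine c * f i (Z i w))%:E)%E; last first.
  by rewrite cZ// big_cons /c [LHS]muleC muleA.
(* With the other factors collected in [G], both sides integrate a function of [Z i]; on indicators
   the induction hypothesis applies with [i] moved into the second list. *)
apply: (eq_weighted_integral (G1 := G) (G2 := cst (fine c)) (Z1 := Z i)) => //.
- exact: mZ.
- exact: mZ.
move=> B mB; rewrite cZ//.
pose A' j := if j == i then B else A j.
have A'i : A' i = B by rewrite /A' eqxx.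
have mA' j : measurable (A' j) by rewrite /A'; case: ifP.
have A's2 j : j \in s2 -> A' j = A j.
  by rewrite /A'; case: eqP => // ->; rewrite (negbTE nis2).
have := ih (i :: s2) A' mA' us1 sE; rewrite big_cons A'i.
rewrite (eq_big_seq _ (fun j js => congr1 (fun C => P (Z j @^-1` C)) (A's2 j js))).
move=> hih; transitivity (\int[P]_w ((\prod_(j <- s1) f j (Z j w)) *
    (\prod_(j <- i :: s2) \1_(A' j) (Z j w)))%:E)%E.
  apply: eq_integral => w _; rewrite big_cons A'i.
  rewrite (eq_big_seq _ (fun j js => congr1 (fun C => \1_C (Z j w)) (A's2 j js))).
  by rewrite /G mulrAC mulrA.
rewrite hih muleCA muleC /c; congr (_ * _)%E.
rewrite (_ : (fun w => _) = (fun w => (\1_(Z i @^-1` B) w)%:E))//.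
rewrite integral_indic ?setIT//.
by rewrite -[_ @^-1` _]setTI; apply: mZ.
Qed.

End independence.

(** * Elementary bounds on the exponential function *)

Section expR_bounds.
Context (R : realType).
Implicit Types x y l : R.

Lemma expR_half x : expR x = expR (x / 2) ^+ 2.
Proof. by rewrite -expRM_natl; congr expR; field. Qed.

(** This is 2 cosh x - 2 = 4 sinh (x / 2) ^ 2; being a square, it reduces quadratic bounds on the
    left-hand side to linear bounds on the base. *)
Lemma expR_sumN x : expR x + expR (- x) - 2 = (expR (x / 2) - expR (- x / 2)) ^+ 2.
Proof.
have ab : expR (x / 2) * expR (- x / 2) = 1.
  by rewrite -expRD -[RHS]expR0; congr expR; ring.
by rewrite sqrrB ab -!expR_half; ring.
Qed.

Lemma expR_sumN_ge2 x : 2 <= expR x + expR (- x).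
Proof. by rewrite -subr_ge0 expR_sumN sqr_ge0. Qed.

Lemma expR_norm_le x : expR `|x| <= expR x + expR (- x).
Proof.
by have [x0|x0] := ger0P x; rewrite ?lerDl ?lerDr expR_ge0.
Qed.

Lemma expR_sumN_norm x : expR x + expR (- x) = expR `|x| + expR (- `|x|).
Proof. by have [x0|x0] := ger0P x => //; rewrite opprK addrC. Qed.

Lemma expR_sumN_ub x : expR x + expR (- x) - 2 <= x ^+ 2 * expR `|x|.
Proof.
rewrite expR_sumN_norm -[x ^+ 2]real_normK ?num_real//.
have := normr_ge0 x; move: `|x| => y y0.
rewrite expR_sumN (expR_half y) -exprMn ler_sqr ?nnegrE.
- have -> : expR (- y / 2) = expR (y / 2) * expR (- y).
    by rewrite -expRD; congr expR; field.
  have := expR_ge1Dx (- y); have := expR_gt0 (y / 2); nra.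
- by rewrite subr_ge0 ler_expR; lra.
- by rewrite mulr_ge0 ?expR_ge0.
Qed.

Lemma expR_sumN_lb x : x ^+ 2 * (1 - `|x|) <= expR x + expR (- x) - 2.
Proof.
rewrite expR_sumN_norm -[x ^+ 2]real_normK ?num_real//.
have := normr_ge0 x; move: `|x| => y y0.
apply: (@le_trans _ _ ((y * expR (- y / 2)) ^+ 2)).
  rewrite exprMn -expR_half ler_wpM2l ?sqr_ge0//.
  exact: expR_ge1Dx.
rewrite expR_sumN ler_sqr ?nnegrE.
- have -> : expR (y / 2) = expR (- y / 2) * expR y.
    by rewrite -expRD; congr expR; field.
  have := expR_ge1Dx y; have := expR_gt0 (- y / 2); nra.
- by rewrite mulr_ge0 ?expR_ge0.
- by rewrite subr_ge0 ler_expR; lra.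
Qed.

(* Second-order expansion of cosh with a remainder of order l ^ 3 that is
   integrable for a Gaussian variable. *)
Lemma expR_sumN_expand l y : 0 < l <= 1 ->
  expR (l * y) + expR (- (l * y)) <=
  2 + l ^+ 2 * y ^+ 2 + 6 * l ^+ 3 * (expR (2 * y) + expR (- (2 * y))).
Proof.
move=> /andP[l0 l1]; set z := `|l * y|.
have zE : z = l * `|y| by rewrite /z normrM gtr0_norm.
have y0 := normr_ge0 y.
have h1 := expR_sumN_ub (l * y); rewrite -/z in h1.
have h2 : expR z <= 1 + z * expR z.
  have := expR_ge1Dx (- z); rewrite expRN => h.
  have := expR_gt0 z => ez.
  have : (1 - z) * expR z <= 1 by rewrite -ler_pdivlMr// div1r.
  lra.
(* The 6 is 3!, from |y| ^ 3 <= 6 exp |y|; the other factor exp (l |y|) is at most exp |y| because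
   [l] is at most 1. *)
have h3 : z ^+ 3 * expR z <= 6 * l ^+ 3 * expR (2 * `|y|).
  rewrite zE exprMn [leLHS](_ : _ = l ^+ 3 * (`|y| ^+ 3 * expR (l * `|y|))); last by ring.
  rewrite [leRHS](_ : _ = l ^+ 3 * (6 * expR (2 * `|y|))); last by ring.
  rewrite ler_wpM2l ?exprn_ge0 ?(ltW l0)//.
  have h4 : `|y| ^+ 3 <= 6 * expR `|y|.
    have := expR_ge1Dxn 2 y0; rewrite (_ : 3`!%:R = 6) => [h|]; last first.
      by rewrite /factorial/=; lra.
    by rewrite mulrC -ler_pdivrMr//; lra.
  rewrite (_ : 2 * `|y| = `|y| + `|y|); last by ring.
  rewrite expRD mulrA ler_pM ?exprn_ge0 ?expR_ge0// ler_expR.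
  by rewrite ler_piMl.
have h5 : expR (2 * `|y|) <= expR (2 * y) + expR (- (2 * y)).
  by rewrite -[2 in leLHS]ger0_norm// -normrM expR_norm_le.
have h6 : l ^+ 2 * y ^+ 2 = z ^+ 2.
  by rewrite zE exprMn real_normK ?num_real.
have h7 : 6 * l ^+ 3 * expR (2 * `|y|) <=
    6 * l ^+ 3 * (expR (2 * y) + expR (- (2 * y))).
  by rewrite ler_wpM2l// mulr_ge0 ?exprn_ge0// ltW.
rewrite exprMn h6 in h1.
have h8 : z ^+ 2 * expR z <= z ^+ 2 * (1 + z * expR z) by rewrite ler_wpM2l ?sqr_ge0.
rewrite h6; rewrite mulrDr mulr1 mulrA -exprSr in h8; lra.
Qed.

End expR_bounds.

(** * Gaussian variables through their moment generating functions *)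

Lemma integral_normal_expR (R : realType) (sg s : R) : sg != 0 ->
  (\int[lebesgue_measure]_x (normal_pdf 0 sg x * expR (s * x))%:E =
   (expR (s ^+ 2 * sg ^+ 2 / 2))%:E)%E.
Proof.
move=> sg0.
(* Completing the square turns the integrand into a constant times the normal density with mean
   [s * sg ^+ 2]. *)
transitivity (\int[lebesgue_measure]_x ((expR (s ^+ 2 * sg ^+ 2 / 2))%:E *
   (normal_pdf (s * sg ^+ 2) sg x)%:E))%E.
  apply: eq_integral => x _; rewrite -EFinM !normal_pdfE//; congr EFin.
  rewrite mulrCA -!mulrA; congr (_ * _); rewrite /normal_fun -!expRD.
  by congr expR; field.
rewrite ge0_integralZl_EFin ?expR_ge0//.
- by rewrite integral_normal_pdf mule1.
- by move=> x _; rewrite lee_fin normal_pdf_ge0.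
- by apply/measurable_EFinP; exact: measurable_normal_pdf.
Qed.

Section ge0_integral_real.
Context d (Y : measurableType d) (R : realType) (mu : {measure set Y -> \bar R}).

Lemma ge0_integral_add (f g : Y -> R) :
  measurable_fun setT f -> measurable_fun setT g ->
  (forall w, 0 <= f w) -> (forall w, 0 <= g w) ->
  (\int[mu]_w (f w + g w)%:E = \int[mu]_w (f w)%:E + \int[mu]_w (g w)%:E)%E.
Proof.
move=> mf mg f0 g0; rewrite -ge0_integralD//.
- by move=> w _; rewrite lee_fin.
- exact/measurable_EFinP.
- by move=> w _; rewrite lee_fin.
- exact/measurable_EFinP.
Qed.

Lemma ge0_integral_mulc (c : R) (f : Y -> R) :
  measurable_fun setT f -> (forall w, 0 <= f w) -> 0 <= c ->
  (\int[mu]_w (c * f w)%:E = c%:E * \int[mu]_w (f w)%:E)%E.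
Proof.
move=> mf f0 c0; rewrite -ge0_integralZl_EFin//.
- by move=> w _; rewrite lee_fin.
- exact/measurable_EFinP.
Qed.

Lemma le_integral_EFin (f g : Y -> R) :
  measurable_fun setT f -> measurable_fun setT g ->
  (forall w, 0 <= f w) -> (forall w, f w <= g w) ->
  (\int[mu]_w (f w)%:E <= \int[mu]_w (g w)%:E)%E.
Proof.
move=> mf mg f0 fg; apply: ge0_le_integral => //.
- by move=> w _; rewrite lee_fin.
- exact/measurable_EFinP.
- exact/measurable_EFinP.
- by move=> w _; rewrite lee_fin.
Qed.

End ge0_integral_real.

Section gaussian_mgf.
Context dO (Omega : measurableType dO) (R : realType) (P : probability Omega R).
Implicit Types (Z S : Omega -> R) (v s b r : R).

(** Encodes a centred Gaussian variable of variance [v] by its moment generating function, so that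
    independent sums become products and [v = 0] is included. *)
Definition gaussian_mgf Z v := measurable_fun setT Z /\
  forall s, (\int[P]_w (expR (s * Z w))%:E = (expR (s ^+ 2 * v / 2))%:E)%E.

Lemma measurable_expRM Z s : measurable_fun setT Z ->
  measurable_fun setT (fun w => expR (s * Z w)).
Proof.
by move=> mZ; apply: measurableT_comp => //; exact: measurable_funM.
Qed.

Lemma integral_probability_cst (c : R) : (\int[P]_w c%:E = c%:E)%E.
Proof. by rewrite integral_cst//= probability_setT mule1. Qed.

Lemma gaussian_mgf_law Z sg : sg != 0 ->
  has_law P Z (normal_prob 0 sg) -> gaussian_mgf Z (sg ^+ 2).
Proof.
move=> sg0 [mZ hZ]; split => // s; rewrite -(integral_normal_expR s sg0).
transitivity (\int[P]_w (cst 1 w * expR (s * Z w))%:E)%E.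
  by apply: eq_integral => w _; rewrite mul1r.
apply: (@eq_weighted_integral _ _ _ _ _ _ _ _ lebesgue_measure _
  (normal_pdf 0 sg) _ id _ _ _ _ _ _ _ (fun x => expR (s * x))) => //.
- exact: measurable_normal_pdf.
- by move=> y; exact: normal_pdf_ge0.
- move=> B mB; transitivity (P (Z @^-1` B)).
    transitivity (\int[P]_w (\1_(Z @^-1` B) w)%:E)%E.
      by apply: eq_integral => w _; rewrite mul1r.
    by rewrite integral_indic ?setIT// -[_ @^-1` _]setTI; exact: mZ.
  rewrite hZ// /normal_prob [LHS]integral_mkcond; apply: eq_integral => x _.
  by rewrite patchE indicE; case: ifPn => _; rewrite ?mulr1 ?mulr0.
- by apply: measurableT_comp => //; exact: measurable_funM.
Qed.

Lemma gaussian_mgf0 Z : (forall w, Z w = 0) -> gaussian_mgf Z 0.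
Proof.
move=> Z0; have -> : Z = cst 0 by apply/funext.
split=> [|s]; first exact: measurable_cst.
transitivity (\int[P]_w (1 : R)%:E)%E.
  by apply: eq_integral => w _; rewrite /= mulr0 expR0.
by rewrite integral_probability_cst mulr0 mul0r expR0.
Qed.

Lemma gaussian_mgf_sum (D : set nat) (X : nat -> Omega -> R) (v c : nat -> R)
    (t : seq nat) : mutually_independent P D X -> uniq t -> [set` t] `<=` D ->
  (forall i, D i -> gaussian_mgf (X i) (v i)) ->
  gaussian_mgf (fun w => \sum_(i <- t) c i * X i w)
    (\sum_(i <- t) c i ^+ 2 * v i).
Proof.
move=> indep ut tD gX; split.
  (* [X i] is known to be measurable only for [i] in [t], so the summand is set to 0 at other
     indices. *)
  rewrite (_ : (fun w => _) =
    fun w => \sum_(i <- t) (if i \in t then c i * X i w else 0)); last first.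
    by apply/funext => w; rewrite big_seq big_mkcond.
  apply: measurable_sum => i; have [it|_] := boolP (i \in t).
    by apply: measurable_funM => //; case: (gX i (tD _ it)).
  exact: measurable_cst.
move=> s.
transitivity (\int[P]_w (\prod_(i <- t) expR (s * c i * X i w))%:E)%E.
  apply: eq_integral => w _; congr EFin; rewrite mulr_sumr expR_sum.
  by apply: eq_bigr => i _; rewrite mulrA.
rewrite (@expectation_prod _ _ _ P D X t (fun i x => expR (s * c i * x)))//.
- rewrite mulr_sumr mulr_suml expR_sum -prodEFin.
  apply: eq_big_seq => i it; have [_ ->] := gX i (tD _ it).
  by congr (expR _)%:E; ring.
- by move=> i /gX[].
- by move=> i; apply: measurableT_comp => //; exact: measurable_funM.
- by move=> i Di; have [_ ->] := gX i Di.
Qed.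

Lemma gaussian_mgf_affine Z v b r s : gaussian_mgf Z v ->
  (\int[P]_w (expR (s * (b + r * Z w)))%:E =
   (expR (s * b) * expR ((s * r) ^+ 2 * v / 2))%:E)%E.
Proof.
move=> [mZ gZ]; rewrite [in RHS]EFinM -(gZ (s * r)).
have mE := measurable_expRM (s * r) mZ.
have E0 w : 0 <= expR (s * r * Z w) by exact: expR_ge0.
rewrite -(ge0_integral_mulc P mE E0 (expR_ge0 _)).
by apply: eq_integral => w _; rewrite -expRD; congr (expR _)%:E; ring.
Qed.

Lemma measurable_affine Z b r : measurable_fun setT Z ->
  measurable_fun setT (fun w => b + r * Z w).
Proof.
by move=> mZ; apply: measurable_funD => //; exact: measurable_funM.
Qed.

(* The second moment is read off the moment generating function at +l and -l
   as l tends to 0. *)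
Lemma gaussian_mgf_sqr Z v b r : gaussian_mgf Z v -> 0 <= v ->
  ((b ^+ 2 + r ^+ 2 * v)%:E <= \int[P]_w ((b + r * Z w) ^+ 2)%:E)%E.
Proof.
move=> gZ v0; have [mZ _] := gZ.
pose Y w := b + r * Z w.
have mY : measurable_fun setT Y by exact: measurable_affine.
have mE s : measurable_fun setT (fun w => expR (s * Y w)).
  exact: measurable_expRM.
have mEN s : measurable_fun setT (fun w => expR (- (s * Y w))).
  by apply: measurableT_comp => //; apply: measurableT_comp => //;
    exact: measurable_funM.
have mYY : measurable_fun setT (fun w => Y w ^+ 2) by exact: measurable_funX.
have EN s : (\int[P]_w (expR (s * Y w) + expR (- (s * Y w)))%:E =
    ((expR (s * b) + expR (- (s * b))) * expR ((s * r) ^+ 2 * v / 2))%:E)%E.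
  rewrite ge0_integral_add//; try by move=> w; rewrite expR_ge0.
  rewrite (gaussian_mgf_affine b r s gZ).
  under [X in (_ + X)%E]eq_integral do rewrite -mulNr.
  rewrite (gaussian_mgf_affine b r (- s) gZ) mulNr -EFinD; congr EFin.
  by rewrite mulNr sqrrN; ring.
set K := (expR (2 * b) + expR (- (2 * b))) * expR ((2 * r) ^+ 2 * v / 2).
have K0 : 0 <= K by rewrite mulr_ge0 ?addr_ge0 ?expR_ge0.
have m0 : (0 <= \int[P]_w (Y w ^+ 2)%:E)%E.
  by apply: integral_ge0 => w _; rewrite lee_fin sqr_ge0.
rewrite -[leRHS]/(\int[P]_w (Y w ^+ 2)%:E)%E.
(* The expansion of cosh at [l * Y], integrated: the left-hand side comes from the moment generating
   function, and the mean in the remainder is [K]. *)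
have key l : 0 < l <= 1 ->
    (((expR (l * b) + expR (- (l * b))) * expR ((l * r) ^+ 2 * v / 2))%:E <=
     2%:E + ((l ^+ 2)%:E * \int[P]_w (Y w ^+ 2)%:E +
             (6 * l ^+ 3)%:E * K%:E))%E.
  move=> l01; have /andP[l0 _] := l01.
  have l3 : 0 <= 6 * l ^+ 3 by rewrite mulr_ge0 ?exprn_ge0 ?(ltW l0).
  rewrite -EN /K -EN.
  have mS : measurable_fun setT
      (fun w => expR (2 * Y w) + expR (- (2 * Y w))) by exact: measurable_funD.
  have S0 w : 0 <= expR (2 * Y w) + expR (- (2 * Y w)).
    by rewrite addr_ge0 ?expR_ge0.
  rewrite -!ge0_integral_mulc ?sqr_ge0//; last by move=> w; exact: sqr_ge0.
  rewrite -ge0_integral_add//; first last.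
  - by move=> w; rewrite mulr_ge0.
  - by move=> w; rewrite mulr_ge0 ?sqr_ge0.
  - exact: measurable_funM.
  - exact: measurable_funM.
  have -> : (2 : R)%:E = (\int[P]_w (2 : R)%:E)%E.
    by rewrite integral_probability_cst.
  rewrite -ge0_integral_add//; first last.
  - by move=> w; apply: addr_ge0; [rewrite mulr_ge0 ?sqr_ge0|rewrite mulr_ge0].
  - by apply: measurable_funD; exact: measurable_funM.
  apply: le_integral_EFin.
  - exact: measurable_funD.
  - by apply: measurable_funD => //; apply: measurable_funD; exact: measurable_funM.
  - by move=> w; rewrite addr_ge0 ?expR_ge0.
  - by move=> w; rewrite addrA; exact: expR_sumN_expand.
move: m0 key; case: (\int[P]_w _)%E => [m|_ _|]//; last by rewrite leey.
rewrite !lee_fin => m0 key.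
apply/ler_addgt0Pl => x x0.
(* [6 * K] pays for the cubic remainder of the upper expansion, the cube of |b| for that of the
   lower bound at [l * b], and 1 makes [B] positive. *)
pose B := 6 * K + `|b| ^+ 3 + 1.
have b3 : 0 <= `|b| ^+ 3 by rewrite exprn_ge0.
have B0 : 0 < B by rewrite /B; lra.
pose l := Num.min 1 (x / B).
have l0 : 0 < l by rewrite lt_min ltr01 divr_gt0.
have l1 : l <= 1 by rewrite ge_min lexx.
have lB : l * B <= x by rewrite -ler_pdivlMr// ge_min lexx orbT.
have := key l; rewrite l0 l1 -!EFinM -!EFinD lee_fin => /(_ isT) {}key.
have h1 := expR_sumN_lb (l * b).
have h2 := expR_sumN_ge2 (l * b).
have h3 := expR_ge1Dx ((l * r) ^+ 2 * v / 2).
set A := expR (l * b) + _ in key h1 h2.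
have h4 : A + (l * r) ^+ 2 * v <= A * expR ((l * r) ^+ 2 * v / 2).
  apply: (@le_trans _ _ (A * (1 + (l * r) ^+ 2 * v / 2))).
    have : 0 <= (l * r) ^+ 2 * v by rewrite mulr_ge0 ?sqr_ge0.
    nra.
  by rewrite ler_wpM2l//; lra.
have h5 : (l * b) ^+ 2 * `|l * b| = l ^+ 3 * `|b| ^+ 3.
  by rewrite -(real_normK (num_real (l * b))) -exprSr normrM gtr0_norm// exprMn.
have h6 : l ^+ 2 * (b ^+ 2 + r ^+ 2 * v) <= l ^+ 2 * (m + l * B).
  have : l ^+ 3 >= 0 by rewrite exprn_ge0// ltW.
  rewrite mulrBr mulr1 h5 in h1.
  rewrite /B; move: (`|b| ^+ 3) b3 h1 => q b3 h1 l3; clearbody K; nra.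
have l2 : 0 < l ^+ 2 by rewrite exprn_gt0.
by move: h6; rewrite ler_pM2l//; lra.
Qed.

End gaussian_mgf.

(** * Limits in mean square of Gaussian variables *)

Section gaussian_limit.
Context dO (Omega : measurableType dO) (R : realType) (P : probability Omega R).
Implicit Types (Z S : Omega -> R) (v s b r : R).

(* The factor 2 in the last bound costs only a constant in the theorem. *)
Definition gaussian_approx Z v := measurable_fun setT Z /\
  forall e, 0 < e -> exists S v', [/\ gaussian_mgf P S v', 0 <= v',
    (\int[P]_w ((Z w - S w) ^+ 2)%:E <= e%:E)%E,
    v' <= v + e & v <= 2 * v' + e].

(** Replacing [S] by [Z] through (x + y) ^ 2 <= 2 x ^ 2 + 2 y ^ 2 costs a factor 2, and
    [v <= 2 * v' + e] costs another, hence the 4. The error terms add up to [5 * r ^+ 2 * e]. *)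
Lemma gaussian_approx_sqr Z v b r : gaussian_approx Z v ->
  ((b ^+ 2 + r ^+ 2 * v)%:E <= 4%:E * \int[P]_w ((b + r * Z w) ^+ 2)%:E)%E.
Proof.
move=> [mZ aZ].
have mY : measurable_fun setT (fun w => (b + r * Z w) ^+ 2).
  by apply: measurable_funX; exact: measurable_affine.
have m0 : (0 <= \int[P]_w ((b + r * Z w) ^+ 2)%:E)%E.
  by apply: integral_ge0 => w _; rewrite lee_fin sqr_ge0.
have key e : 0 < e -> ((b ^+ 2 + r ^+ 2 * v)%:E <=
    4%:E * \int[P]_w ((b + r * Z w) ^+ 2)%:E + (5 * r ^+ 2 * e)%:E)%E.
  move=> e0; have [S [v' [gS v'0 ZS _ vv']]] := aZ e e0.
  have [mS _] := gS; have h := gaussian_mgf_sqr b r gS v'0.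
  have mZS : measurable_fun setT (fun w => (Z w - S w) ^+ 2).
    by apply: measurable_funX; exact: measurable_funB.
  have {}h : ((b ^+ 2 + r ^+ 2 * v')%:E <=
      2%:E * \int[P]_w ((b + r * Z w) ^+ 2)%:E + (2 * r ^+ 2 * e)%:E)%E.
    apply: (le_trans h).
    apply: (@le_trans _ _ (\int[P]_w (2 * (b + r * Z w) ^+ 2 +
        2 * r ^+ 2 * (Z w - S w) ^+ 2)%:E)%E).
      apply: le_integral_EFin.
      - by apply: measurable_funX; exact: measurable_affine.
      - by apply: measurable_funD; exact: measurable_funM.
      - by move=> w; exact: sqr_ge0.
      - move=> w; have := sqr_ge0 (b + r * Z w + r * (Z w - S w)); nra.
    rewrite ge0_integral_add; first last.
    - by move=> w; rewrite mulr_ge0 ?sqr_ge0// mulr_ge0 ?sqr_ge0.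
    - by move=> w; rewrite mulr_ge0 ?sqr_ge0.
    - exact: measurable_funM.
    - exact: measurable_funM.
    have Y0 w : 0 <= (b + r * Z w) ^+ 2 by exact: sqr_ge0.
    have ZS0 w : 0 <= (Z w - S w) ^+ 2 by exact: sqr_ge0.
    have r2 : 0 <= 2 * r ^+ 2 by have := sqr_ge0 r; lra.
    rewrite !ge0_integral_mulc//.
    rewrite [in leRHS]EFinM leeD2l// lee_wpmul2l//.
  have r0 := sqr_ge0 r; have b0 := sqr_ge0 b.
  move: m0 h; case: (\int[P]_w _)%E => [m|_ _|]//; last first.
    by rewrite gt0_muley ?lte_fin// addye// leey.
  rewrite -!EFinM -!EFinD !lee_fin => m0 h; nra.
move: m0 key; case: (\int[P]_w _)%E => [m|_ _|]//; last first.
  by rewrite gt0_muley ?lte_fin// leey.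
rewrite -EFinM !lee_fin => m0 key; apply/ler_addgt0Pl => x x0.
have r1 : 0 < 5 * r ^+ 2 + 1 by have := sqr_ge0 r; lra.
have := key (x / (5 * r ^+ 2 + 1)) (divr_gt0 x0 r1).
rewrite -EFinD lee_fin => /le_trans; apply; rewrite addrC lerD2r.
by rewrite mulrA ler_pdivrMr// mulrC ler_wpM2l ?ltW//; lra.
Qed.

(** Closeness in mean square does not control exponentials, so the exponential is first truncated at
    [K]. Where [s * (Z w - S w)] is at most [h] it is bounded by [expR h * expR (s * S w)];
    elsewhere [K] is at most [q * (Z w - S w) ^+ 2], as in Chebyshev's inequality. Monotone
    convergence then removes the truncation. *)
Lemma gaussian_approx_expR Z v s : gaussian_approx Z v ->
  (\int[P]_w (expR (s * Z w))%:E <= (expR (s ^+ 2 * v / 2))%:E)%E.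
Proof.
move=> [mZ aZ]; set c := expR _.
have c0 : 0 < c by exact: expR_gt0.
pose trunc (K : nat) w := Num.min (expR (s * Z w)) K%:R.
have mt K : measurable_fun setT (trunc K).
  by apply: measurable_minr; [exact: measurable_expRM|exact: measurable_cst].
have t0 K w : 0 <= trunc K w by rewrite le_min expR_ge0/=.
have bound (K : nat) h : 0 < h ->
    (\int[P]_w (trunc K w)%:E <= (expR (2 * h) * c + h)%:E)%E.
  move=> h0; pose q := K%:R * s ^+ 2 / h ^+ 2.
  have q0 : 0 <= q by rewrite divr_ge0 ?sqr_ge0// mulr_ge0 ?sqr_ge0.
  have s0 := sqr_ge0 s.
  (* Both [q * e] and [s ^+ 2 * e] are then at most [h]. *)
  pose e := Num.min (h / (q + 1)) (h / (s ^+ 2 + 1)).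
  have e0 : 0 < e by rewrite lt_min !divr_gt0//; lra.
  have [S [v' [[mS gS] v'0 ZS vv' _]]] := aZ e e0.
  have mZS : measurable_fun setT (fun w => (Z w - S w) ^+ 2).
    by apply: measurable_funX; exact: measurable_funB.
  apply: (@le_trans _ _ (\int[P]_w (expR h * expR (s * S w) +
      q * (Z w - S w) ^+ 2)%:E)%E).
    apply: le_integral_EFin => //.
      apply: measurable_funD; apply: measurable_funM => //.
      exact: measurable_expRM.
    move=> w; have [ZSh|ZSh] := leP (s * (Z w - S w)) h.
      rewrite -expRD ge_min; apply/orP; left.
      apply: (@le_trans _ _ (expR (h + s * S w))); last first.
        by rewrite lerDl mulr_ge0 ?sqr_ge0.
      by rewrite ler_expR; lra.
    rewrite ge_min; apply/orP; right.
    apply: (@le_trans _ _ (q * (Z w - S w) ^+ 2)); last first.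
      by rewrite lerDr mulr_ge0 ?expR_ge0.
    rewrite /q mulrAC ler_pdivlMr ?exprn_gt0// -mulrA ler_wpM2l//.
    by rewrite -exprMn ler_sqr ?nnegrE ltW// (lt_trans h0).
  rewrite ge0_integral_add; first last.
  - by move=> w; rewrite mulr_ge0 ?sqr_ge0.
  - by move=> w; rewrite mulr_ge0 ?expR_ge0.
  - exact: measurable_funM.
  - by apply: measurable_funM => //; exact: measurable_expRM.
  have ZS0 w : 0 <= (Z w - S w) ^+ 2 by exact: sqr_ge0.
  rewrite !ge0_integral_mulc ?expR_ge0//; last exact: measurable_expRM.
  rewrite gS -EFinM EFinD leeD//.
    rewrite lee_fin /c -!expRD ler_expR.
    have es : e * (s ^+ 2 + 1) <= h.
      by rewrite -ler_pdivlMr ?ge_min ?lexx ?orbT//; lra.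
    nra.
  apply: (@le_trans _ _ (q%:E * e%:E)%E); first by rewrite lee_wpmul2l.
  have eq1 : e * (q + 1) <= h.
    by rewrite -ler_pdivlMr ?ge_min ?lexx//; lra.
  rewrite -EFinM lee_fin; nra.
have {}bound (K : nat) : (\int[P]_w (trunc K w)%:E <= c%:E)%E.
  apply/lee_addgt0Pr => x x0.
  (* For [h] at most 1 / 4, [expR (2 * h)] is at most [1 + 4 * h], so the bound exceeds [c] by at
     most [h * (4 * c + 1)], hence by at most [x]. *)
  pose h := Num.min (1 / 4) (x / (4 * c + 1)).
  have h0 : 0 < h by rewrite lt_min !divr_gt0//; lra.
  have h4 : h <= 1 / 4 by rewrite ge_min lexx.
  have hx : h * (4 * c + 1) <= x.
    by rewrite -ler_pdivlMr ?ge_min ?lexx ?orbT//; lra.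
  apply: (le_trans (bound K h h0)); rewrite -EFinD lee_fin.
  have := expR_ge1Dx (- (2 * h)); rewrite expRN => e1.
  have e2 : (1 - 2 * h) * expR (2 * h) <= 1.
    by rewrite -ler_pdivlMr ?expR_gt0// div1r; lra.
  have := expR_gt0 (2 * h) => e3.
  have e4 : expR (2 * h) <= 1 + 4 * h by nra.
  nra.
have -> : (\int[P]_w (expR (s * Z w))%:E =
    limn (fun K => \int[P]_w (trunc K w)%:E))%E.
  rewrite -monotone_convergence//.
  - apply: eq_integral => w _; apply/esym/cvg_lim => //.
    apply: cvg_near_cst; near=> K; rewrite /trunc; congr EFin.
    apply/min_idPl; near: K; exact: nbhs_infty_ger.
  - by move=> K; exact/measurable_EFinP.
  - by move=> K w _; rewrite lee_fin.
  - move=> w _ a b' ab; rewrite lee_fin /trunc le_min ge_min lexx/=.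
    by rewrite ge_min ler_nat ab orbT.
apply: lime_le; last by near=> K; exact: bound.
apply: ereal_nondecreasing_is_cvgn => a b' ab; apply: le_integral_EFin => //.
move=> w; rewrite /trunc le_min ge_min lexx/=.
by rewrite ge_min ler_nat ab orbT.
Unshelve. all: by end_near. Qed.

End gaussian_limit.

(** * The noise functional in the two models *)

Section gaussian_noise_law.
Context dO (Omega : measurableType dO) (R : realType) (P : probability Omega R).

Lemma gaussian_mgf_increment (X : Omega -> R) (s t : R) : s < t ->
  has_law P X (normal_prob 0 (Num.sqrt (t - s))) -> gaussian_mgf P X (t - s).
Proof.
move=> st /gaussian_mgf_law; rewrite sqr_sqrtr ?subr_ge0 1?ltW//; apply.
by rewrite gt_eqF// sqrtr_gt0 subr_gt0.
Qed.

Lemma gaussian_series_approx (A : set nat) (eps : nat -> Omega -> R)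
    (u : L2 (counting_on R A)) (Z : Omega -> R) :
  iid_standard_normal P A eps -> gaussian_series P A eps u Z ->
  gaussian_approx P Z (l2norm u ^+ 2).
Proof.
move=> [lawe indep] [mZ ZS]; split => // e e0.
pose t N := [seq i <- iota 0 N | i \in A].
pose v N := \sum_(i <- t N) u i ^+ 2 * 1.
pose S N w := \sum_(i <- t N) u i * eps i w.
have tN (F : nat -> R) N : \sum_(i <- t N) F i = \sum_(i < N | (i : nat) \in A) F i.
  by rewrite big_filter -{1}(subn0 N) -/(index_iota 0 N) big_mkord.
have mu2 : measurable_fun setT (fun i => u i ^+ 2) by exact: measurable_funX.
(* For the counting measure the squared norm is the series whose partial sums are the [v N]. *)
have nrm : ((l2norm u ^+ 2)%:E = \sum_(k <oo) ((fun i => (u i ^+ 2)%:E) \_ A) k)%E.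
  rewrite l2norm_sqr_int integral_mrestr//; last by move=> i; exact: sqr_ge0.
  rewrite integral_mkcond ge0_integral_count// => i.
  by rewrite patchE; case: ifPn => // _; rewrite lee_fin sqr_ge0.
have f0 k : (0 <= ((fun i => (u i ^+ 2)%:E) \_ A) k)%E.
  by rewrite patchE; case: ifPn => // _; rewrite lee_fin sqr_ge0.
have vE N : ((v N)%:E = \sum_(0 <= k < N) ((fun i => (u i ^+ 2)%:E) \_ A) k)%E.
  rewrite /v big_filter -{1}(subn0 N) -/(index_iota 0 N) big_mkcond/= -sumEFin.
  by apply: eq_bigr => i _; rewrite patchE; case: ifPn => // _; rewrite mulr1.
have cvgv : v N @[N --> \oo] --> l2norm u ^+ 2.
  have cv : (v N)%:E @[N --> \oo] --> (l2norm u ^+ 2)%:E.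
    by rewrite nrm; under eq_fun do rewrite vE; exact: is_cvg_nneseries.
  exact: (fine_cvg cv).
have [finZS cvgZS] := (fine_cvgP _ _).1 ZS.
have near_v : \forall N \near \oo, `|l2norm u ^+ 2 - v N| <= e.
  by move/cvgrPdist_le : cvgv; apply.
have near_ZS : \forall N \near \oo, ('E_P[fun w => ((Z w -
    \sum_(i < N | (i : nat) \in A) u i * eps i w) ^+ 2)%R] <= e%:E)%E.
  have /cvgrPdist_le/(_ e e0) := cvgZS.
  apply: filterS2 finZS => N fin; rewrite sub0r normrN => h.
  by rewrite -(fineK fin) lee_fin (le_trans (ler_norm _)).
have [N _ /(_ N (leqnn N))[hv hZ]] := filterI near_v near_ZS.
have v0 : 0 <= v N.
  by rewrite /v sumr_ge0// => i _; rewrite mulr1 sqr_ge0.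
exists (S N), (v N); split => //.
- apply: (gaussian_mgf_sum (D := A)) => //.
  + by rewrite filter_uniq// iota_uniq.
  + by move=> i /=; rewrite mem_filter => /andP[/set_mem].
  + move=> i /lawe h; rewrite -(expr1n _ 2); exact: gaussian_mgf_law (oner_neq0 _) h.
- have -> : (fun w => ((Z w - S N w) ^+ 2)%:E) = (fun w => ((Z w -
      \sum_(i < N | (i : nat) \in A) u i * eps i w) ^+ 2)%:E).
    by apply/funext => w; rewrite /S tN.
  by move: hZ; rewrite unlock.
- by move: hv; rewrite ler_norml => /andP[]; lra.
- by move: hv; rewrite ler_norml => /andP[]; lra.
Qed.

(** For monotone [t] the intervals are disjoint, so the cross terms vanish, and indicators equal
    their squares. *)
Lemma sqr_step (t c : R^nat) N (x : R) : nondecreasing_seq t ->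
  (\sum_(l < N) c l * \1_(`]t l, t l.+1]%classic) x) ^+ 2 =
  \sum_(l < N) c l ^+ 2 * \1_(`]t l, t l.+1]%classic) x.
Proof.
move=> ndt; elim: N => [|N ih]; first by rewrite !big_ord0 expr0n.
rewrite !big_ord_recr/= sqrrD ih.
have -> : (\sum_(l < N) c l * \1_(`]t l, t l.+1]%classic) x) *
    (c N * \1_(`]t N, t N.+1]%classic) x) = 0.
  rewrite mulr_suml big1// => l _; rewrite !indicE.
  have [xN|] := boolP (x \in `]t N, t N.+1]%classic); last by rewrite !mulr0.
  have [xl|] := boolP (x \in `]t l, t l.+1]%classic); last by rewrite mulr0 mul0r.
  move: xN xl; rewrite !inE/= !in_itv/= => /andP[tNx _] /andP[_ xtl].
  by have := lt_le_trans tNx (le_trans xtl (ndt _ _ (ltn_ord l))); rewrite ltxx.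
rewrite mul0rn addr0 exprMn; congr (_ + _ * _).
by rewrite indicE; case: (_ \in _); rewrite ?expr1n ?expr0n.
Qed.

(** A step function [phi] close to [u] integrates to a sum of independent increments whose variance
    [V] is the integral of the square of [phi] over [I]. It remains to compare [V] with the squared
    norm of [u]. *)
Lemma wiener_integral_approx (I : interval R) (W : R -> Omega -> R)
    (u : L2 (lebesgue_on I)) (Z : Omega -> R) :
  brownian_motion P I W -> wiener_integral P I W u Z ->
  gaussian_approx P Z (l2norm u ^+ 2).
Proof.
move=> [mW incW indepW _] [mZ stepZ]; split => // e e0.
set s2 := l2norm u ^+ 2.
have s20 : 0 <= s2 by exact: sqr_ge0.
(* In phi ^ 2 <= (1 + k) u ^ 2 + (1 + 1 / k) (u - phi) ^ 2, this [k] keeps [k * s2] below [e / 2],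
   and [e'] below keeps the last integral within [e / 2]. *)
pose k := e / (2 * (s2 + 1)).
have k0 : 0 < k by rewrite divr_gt0// mulr_gt0//; lra.
have k1 : k * s2 <= e / 2.
  by rewrite /k mulrAC ler_pdivrMr ?mulr_gt0//; [nra|lra].
have kV : 0 < k^-1 by rewrite invr_gt0.
pose e' := (e / 2) / (1 + k^-1).
have e'0 : 0 < e' by rewrite !divr_gt0//; lra.
have e'E : (1 + k^-1) * e' = e / 2 by rewrite /e' mulrCA divff ?mulr1// gt_eqF//; lra.
have [N [t [c [tI ndt hu hZ]]]] := stepZ e' e'0.
pose v l := t l.+1 - t l.
pose X l w := W (t l.+1) w - W (t l) w.
pose phi x := \sum_(l < N) c l * \1_(`]t l, t l.+1]%classic) x.
have v0 l : 0 <= v l by rewrite subr_ge0 ndt.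
pose V := \sum_(l <- iota 0 N) c l ^+ 2 * v l.
have mphi : measurable_fun setT phi.
  by apply: measurable_sum => l; apply: measurable_funM => //; exact: measurable_indic.
have mI : measurable [set` I] by exact: measurable_itv.
have phiV : (\int[lebesgue_measure]_(x in [set` I]) (phi x ^+ 2)%:E = V%:E)%E.
  transitivity (\int[lebesgue_measure]_(x in [set` I])
      \sum_(l < N) (c l ^+ 2 * \1_(`]t l, t l.+1]%classic) x)%:E)%E.
    by apply: eq_integral => x _; rewrite /phi sqr_step// sumEFin.
  pose f (l : 'I_N) (x : R) := (c l ^+ 2 * \1_(`]t l, t l.+1]%classic) x)%:E.
  have mf l : measurable_fun [set` I] (f l).
    apply: measurable_funTS; apply/measurable_EFinP.
    by apply: measurable_funM => //; exact: measurable_indic.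
  have f0 l x : [set` I] x -> (0 <= f l x)%E.
    by rewrite lee_fin mulr_ge0 ?sqr_ge0.
  rewrite (ge0_integral_sum lebesgue_measure mI mf f0).
  have -> : V = \sum_(l < N) c l ^+ 2 * v l.
    by rewrite /V -{1}(subn0 N) -/(index_iota 0 N) big_mkord.
  rewrite -sumEFin; apply: eq_bigr => l _.
  rewrite /f; under eq_integral do rewrite EFinM.
  rewrite ge0_integralZl_EFin ?sqr_ge0//; last first.
    by apply: measurable_funTS; apply/measurable_EFinP; exact: measurable_indic.
  rewrite integral_indic// [RHS]EFinM; congr (_ * _)%E.
  (* Endpoints in [I] put the whole piece in [I], so restricting to [I] cuts nothing off. *)
  have tlI : `]t l, t l.+1]%classic `<=` [set` I].
    move=> x /=; rewrite in_itv/= => /andP[tx xt].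
    by apply: (interval_is_interval (tI l) (tI l.+1)); rewrite (ltW tx).
  rewrite (setIidl tlI); apply: (etrans (lebesgue_measure_itv `]t l, t l.+1])).
  rewrite /= lte_fin /v.
  have := ndt _ _ (leqnSn l); rewrite le_eqVlt => /predU1P[->|->]//.
  by rewrite ltxx subrr.
have mu2 : measurable_fun setT (fun x => u x ^+ 2) by exact: measurable_funX.
have mphi2 : measurable_fun setT (fun x => phi x ^+ 2) by exact: measurable_funX.
have mup : measurable_fun setT (fun x => (u x - phi x) ^+ 2).
  by apply: measurable_funX; exact: measurable_funB.
have u0 x : 0 <= u x ^+ 2 by exact: sqr_ge0.
have phi0 x : 0 <= phi x ^+ 2 by exact: sqr_ge0.
have up0 x : 0 <= (u x - phi x) ^+ 2 by exact: sqr_ge0.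
rewrite -(integral_mrestr lebesgue_measure (measurable_itv I) mphi2 phi0) in phiV.
rewrite -(integral_mrestr lebesgue_measure (measurable_itv I) mup up0) in hu.
have uE := l2norm_sqr_int u; rewrite -/s2 in uE.
have hV : V <= s2 + e.
  rewrite -lee_fin -phiV.
  apply: (@le_trans _ _ (\int[lebesgue_on I]_x ((1 + k) * u x ^+ 2 +
      (1 + k^-1) * (u x - phi x) ^+ 2)%:E)%E).
    apply: le_integral_EFin => //.
      by apply: measurable_funD; exact: measurable_funM.
    move=> x; have := sqr_ge0 (k * u x + (u x - phi x)).
    rewrite -(pmulr_rge0 _ kV) => h; rewrite -subr_ge0; move: h; congr (0 <= _).
    by field; rewrite gt_eqF.
  rewrite ge0_integral_add; first last.
  - by move=> x; rewrite mulr_ge0//; lra.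
  - by move=> x; rewrite mulr_ge0//; lra.
  - exact: measurable_funM.
  - exact: measurable_funM.
  have k10 : 0 <= 1 + k by lra.
  have kV0 : 0 <= 1 + k^-1 by lra.
  rewrite !ge0_integral_mulc// -uE.
  apply: (@le_trans _ _ ((1 + k)%:E * s2%:E + (1 + k^-1)%:E * e'%:E)%E).
    by rewrite leeD2l// lee_wpmul2l.
  by rewrite -!EFinM -EFinD lee_fin e'E; lra.
have hs : s2 <= 2 * V + e.
  rewrite -lee_fin uE.
  apply: (@le_trans _ _ (\int[lebesgue_on I]_x (2 * phi x ^+ 2 +
      2 * (u x - phi x) ^+ 2)%:E)%E).
    apply: le_integral_EFin => //.
      by apply: measurable_funD; exact: measurable_funM.
    by move=> x; have := sqr_ge0 (phi x - (u x - phi x)); nra.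
  rewrite ge0_integral_add; first last.
  - by move=> x; rewrite mulr_ge0.
  - by move=> x; rewrite mulr_ge0.
  - exact: measurable_funM.
  - exact: measurable_funM.
  rewrite !ge0_integral_mulc// phiV.
  apply: (@le_trans _ _ (2%:E * V%:E + 2%:E * e'%:E)%E).
    by rewrite leeD2l// lee_wpmul2l.
  rewrite -!EFinM -EFinD lee_fin; nra.
pose S w := \sum_(l <- iota 0 N) c l * X l w.
have SE w : S w = \sum_(l < N) c l * (W (t l.+1) w - W (t l) w).
  by rewrite /S -{1}(subn0 N) -/(index_iota 0 N) big_mkord.
exists S, V; split => //.
- apply: (gaussian_mgf_sum (D := setT) (v := v)) => //; first exact: indepW.
    exact: iota_uniq.
  (* Repeated points give increments that vanish identically; the normal law is available only for
     distinct points. *)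
  move=> l _; have := ndt _ _ (leqnSn l); rewrite le_eqVlt => /predU1P[tE|tlt].
    by rewrite /v -tE subrr; apply: gaussian_mgf0 => w; rewrite /X -tE subrr.
  by apply: gaussian_mgf_increment => //; exact: incW.
- by rewrite /V sumr_ge0// => l _; rewrite mulr_ge0 ?sqr_ge0.
- have -> : (fun w => ((Z w - S w) ^+ 2)%:E) = (fun w => ((Z w -
      \sum_(l < N) c l * (W (t l.+1) w - W (t l) w)) ^+ 2)%:E).
    by apply/funext => w; rewrite SE.
  move: hZ; rewrite unlock => /le_trans; apply; rewrite lee_fin; nra.
Qed.

Lemma gaussian_noise_approx d (X : measurableType d)
    (mu : {measure set X -> \bar R}) (J : L2 mu -> Omega -> R) :
  gaussian_noise P J -> forall u, gaussian_approx P (J u) (l2norm u ^+ 2).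
Proof.
case=> [I W J' bW wJ u|A eps J' iid sJ u].
  exact: wiener_integral_approx bW (wJ u).
exact: gaussian_series_approx iid (sJ u).
Qed.

End gaussian_noise_law.

(** * Moments of a maximum of sub-Gaussian variables *)

Section max_moment.
Context dO (Omega : measurableType dO) (R : realType) (P : probability Omega R).

(** This is z <= exp z at z = y / (2 p), raised to the power [p]. *)
Lemma powR_le_expR (p y : R) : 1 <= p -> 0 <= y ->
  y `^ p <= (2 * p) `^ p * expR (y / 2).
Proof.
move=> p1 y0; have p0 : 0 < 2 * p by lra.
have -> : y = 2 * p * (y / (2 * p)) by rewrite mulrCA divff ?mulr1// gt_eqF.
set z := y / _; have z0 : 0 <= z by rewrite divr_ge0// ltW.
rewrite powRM ?(ltW p0)// ler_wpM2l ?powR_ge0//.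
rewrite (_ : 2 * p * z / 2 = z * p); last by field.
rewrite expRM ge0_ler_powR ?nnegrE ?expR_ge0//; first lra.
by have := expR_ge1Dx z; lra.
Qed.

Lemma ln2_ge : 1 / 2 <= ln 2 :> R.
Proof.
have := @le_ln1Dx R (- (1 / 2)); rewrite (_ : 1 + - (1 / 2) = 2^-1); last by field.
rewrite lnV ?posrE// => h.
have : -1 < - (1 / 2) :> R by lra.
by move/h; lra.
Qed.

(* Splitting at 1 + N = 8 sqrt (ln k): below, the power is bounded outright;
   above, it is dominated by k^-5 exp (2 sqrt (ln k) N). *)
Lemma powR_split (p N : R) (k : nat) : 1 <= p -> 0 <= N -> (2 <= k)%N ->
  (1 + N) `^ p <= Num.sqrt (ln k%:R) `^ p *
    (8 `^ p + (2 * p) `^ p * (k%:R ^- 5 * expR (2 * Num.sqrt (ln k%:R) * N))).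
Proof.
move=> p1 N0 k2; set L := Num.sqrt _.
have k0 : 0 < k%:R :> R by rewrite ltr0n (leq_trans _ k2).
have lnk : 1 / 2 <= ln k%:R :> R.
  by apply: (le_trans ln2_ge); rewrite ler_ln ?posrE// ler_nat.
have L2 : L ^+ 2 = ln k%:R by rewrite sqr_sqrtr//; lra.
have L0 : 0 < L by rewrite sqrtr_gt0; lra.
pose y := (1 + N) / L.
have y0 : 0 <= y by rewrite divr_ge0 ?ltW//; lra.
have yE : 1 + N = L * y by rewrite /y mulrCA divff ?mulr1// gt_eqF.
rewrite yE (powRM _ (ltW L0) y0) ler_wpM2l ?powR_ge0//.
have p0 : 0 <= p by lra.
have kE : k%:R ^- 5 * expR (2 * L * N) = expR (2 * L * N - 5 * L ^+ 2).
  by rewrite expRD expRN L2 expRM_natl lnK ?posrE// mulrC.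
have [y8|y8] := leP y 8.
  apply: (@le_trans _ _ (8 `^ p)); first by rewrite ge0_ler_powR ?nnegrE.
  by rewrite lerDl mulr_ge0 ?powR_ge0// kE expR_ge0.
apply: (@le_trans _ _ ((2 * p) `^ p * expR (y / 2))).
  exact: powR_le_expR.
apply: (@le_trans _ _ ((2 * p) `^ p * expR (2 * L * N - 5 * L ^+ 2))).
  rewrite ler_wpM2l ?powR_ge0// ler_expR.
  have -> : 2 * L * N - 5 * L ^+ 2 = 2 * y * L ^+ 2 - 2 * L - 5 * L ^+ 2.
    by rewrite (_ : N = L * y - 1); [ring|lra].
  (* For [y] above 8, the bound 2 L <= L ^ 2 + 1 reduces the claim to 10 L ^ 2 >= 5, which is ln k
     >= 1 / 2. *)
  have : 0 <= (L - 1) ^+ 2 by exact: sqr_ge0.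
  nra.
by rewrite kE lerDr powR_ge0.
Qed.

(** The exponential of the largest |X i| is at most [1 + \sum_i E i w], where the 1 covers a maximum
    of 0. At parameter [2 * L] each [E i] has mean at most 2 k ^ 2, and the sum over at most 2 k ^ 2
    indices is absorbed by the factor k ^ (-5) of [powR_split]. *)
Lemma subgaussian_max_moment (I : finType) (X : I -> Omega -> R) (Y : Omega -> R)
    (A p : R) (k : nat) : 1 <= p -> 0 <= A -> (2 <= k)%N ->
  (#|I| <= 2 * k ^ 2)%N ->
  (forall i, measurable_fun setT (X i)) -> measurable_fun setT Y ->
  (forall i s, \int[P]_w (expR (s * X i w))%:E <= (expR (s ^+ 2 / 2))%:E)%E ->
  (forall w N, 0 <= N -> (forall i, `|X i w| <= N) -> `|Y w| <= A * (1 + N)) ->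
  (\int[P]_w (`|Y w| `^ p)%:E <=
    ((8 `^ p + 5 * (2 * p) `^ p) * A `^ p * (ln k%:R) `^ (p / 2))%:E)%E.
Proof.
move=> p1 A0 k2 cardI mX mY subX YN; set L := Num.sqrt (ln k%:R : R).
have k0 : 0 < k%:R :> R by rewrite ltr0n (leq_trans _ k2).
have lnk : 1 / 2 <= ln k%:R :> R.
  by apply: (le_trans ln2_ge); rewrite ler_ln ?posrE// ler_nat.
have L2 : L ^+ 2 = ln k%:R by rewrite sqr_sqrtr//; lra.
pose E i w := expR (2 * L * X i w) + expR (- (2 * L) * X i w).
have E0 i w : 0 <= E i w by rewrite addr_ge0 ?expR_ge0.
have mE i : measurable_fun setT (E i).
  by apply: measurable_funD; exact: measurable_expRM.
pose c := A `^ p * L `^ p.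
have c0 : 0 <= c by rewrite mulr_ge0 ?powR_ge0.
pose q := (2 * p) `^ p * k%:R ^- 5.
have q0 : 0 <= q by rewrite mulr_ge0 ?powR_ge0// invr_ge0 exprn_ge0// ltW.
have mS : measurable_fun setT (fun w => 1 + \sum_i E i w).
  by apply: measurable_funD => //; exact: measurable_sum.
have S0 w : 0 <= 1 + \sum_i E i w by rewrite addr_ge0// sumr_ge0.
have pt w : `|Y w| `^ p <= c * (8 `^ p + q * (1 + \sum_i E i w)).
  pose N := \big[Num.max/0]_i `|X i w|.
  have XN i : `|X i w| <= N by exact: le_bigmax.
  have N0 : 0 <= N by exact: bigmax_ge_id.
  apply: (@le_trans _ _ ((A * (1 + N)) `^ p)).
    rewrite ge0_ler_powR ?nnegrE ?mulr_ge0 ?addr_ge0//; first lra.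
    exact: YN.
  rewrite powRM ?addr_ge0// /c -mulrA ler_wpM2l ?powR_ge0//.
  apply: (le_trans (powR_split p1 N0 k2)); rewrite -/L ler_wpM2l ?powR_ge0//.
  rewrite lerD2l /q mulrA ler_wpM2l//.
  have : N = 0 \/ exists i, N = `|X i w|.
    rewrite /N; elim/big_ind: _ => [|x y hx hy|i _]; [by left| |by right; exists i].
    by rewrite /Num.max; case: ifP.
  case=> [->|[i ->]]; first by rewrite mulr0 expR0 lerDl sumr_ge0.
  apply: (@le_trans _ _ (E i w)).
    have L0 : 0 <= 2 * L by rewrite mulr_ge0// sqrtr_ge0.
    have := expR_norm_le (2 * L * X i w).
    by rewrite normrM (ger0_norm L0) /E mulNr.
  by rewrite (bigD1 i)//= addrCA lerDl addr_ge0// sumr_ge0.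
have EE i : (\int[P]_w (E i w)%:E <= (2 * k%:R ^+ 2)%:E)%E.
  rewrite ge0_integral_add; first last.
  - by move=> w; exact: expR_ge0.
  - by move=> w; exact: expR_ge0.
  - exact: measurable_expRM.
  - exact: measurable_expRM.
  have kE : expR ((2 * L) ^+ 2 / 2) = k%:R ^+ 2.
    rewrite exprMn L2 (_ : _ / 2 = 2 * ln k%:R); last by field.
    by rewrite expRM_natl lnK ?posrE.
  rewrite (_ : 2 * k%:R ^+ 2 = k%:R ^+ 2 + k%:R ^+ 2); last by ring.
  rewrite EFinD leeD// -kE; first exact: subX.
  by rewrite -sqrrN; exact: subX.
(* The count gives 1 + 4 k ^ 4, which is at most 5 k ^ 5. *)
have SE : (\int[P]_w (1 + \sum_i E i w)%:E <= (5 * k%:R ^+ 5)%:E)%E.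
  rewrite ge0_integral_add//; last by move=> w; rewrite sumr_ge0.
    rewrite integral_probability_cst.
    under eq_integral do rewrite -sumEFin.
    rewrite (ge0_integral_sum P measurableT (f := fun i w => (E i w)%:E)); last 2 first.
    - by move=> i; exact/measurable_EFinP.
    - by move=> i w _; rewrite lee_fin.
    apply: (@le_trans _ _ (1%:E + \sum_(i : I) (2 * k%:R ^+ 2)%:E)%E).
      by rewrite leeD2l// lee_sum.
    rewrite sumEFin -EFinD lee_fin sumr_const.
    rewrite -[X in _ + X]mulr_natr.
    have hc : #|I|%:R <= 2 * k%:R ^+ 2 :> R by rewrite -natrX -natrM ler_nat.
    have k2' : 2 <= k%:R :> R by rewrite ler_nat.
    have k20 : 0 <= 2 * k%:R ^+ 2 :> R by rewrite mulr_ge0 ?sqr_ge0.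
    have := ler_wpM2l k20 hc => h.
    have k21 : 1 <= k%:R ^+ 2 :> R by rewrite exprn_ege1//; lra.
    have k4 : 1 <= k%:R ^+ 4 :> R by rewrite exprn_ege1//; lra.
    have k5 : k%:R ^+ 4 <= k%:R ^+ 5 :> R by rewrite ler_weXn2l//; lra.
    have e4 : 2 * k%:R ^+ 2 * (2 * k%:R ^+ 2) = 4 * k%:R ^+ 4 :> R by ring.
    rewrite e4 in h; lra.
  exact: measurable_sum.
apply: (@le_trans _ _ (\int[P]_w (c * (8 `^ p + q * (1 + \sum_i E i w)))%:E)%E).
  apply: le_integral_EFin => //.
  - apply: (measurableT_comp (measurable_powR _)) => //.
    exact: measurableT_comp.
  - by apply: measurable_funM => //; apply: measurable_funD => //;
      exact: measurable_funM.
rewrite ge0_integral_mulc//; first last.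
- by move=> w; rewrite addr_ge0 ?powR_ge0// mulr_ge0.
- by apply: measurable_funD => //; exact: measurable_funM.
rewrite ge0_integral_add//; first last.
- by move=> w; rewrite mulr_ge0.
- exact: measurable_funM.
rewrite integral_probability_cst ge0_integral_mulc//.
apply: (@le_trans _ _ (c%:E * ((8 `^ p)%:E + q%:E * (5 * k%:R ^+ 5)%:E))%E).
  by rewrite lee_wpmul2l// leeD2l// lee_wpmul2l.
rewrite -!EFinM lee_fin /q.
have -> : (2 * p) `^ p * k%:R ^- 5 * (5 * k%:R ^+ 5) = 5 * (2 * p) `^ p.
  by field; rewrite gt_eqF.
rewrite /c (_ : ln k%:R `^ (p / 2) = L `^ p) ?le_eqVlt; last first.
  by rewrite /L -powR12_sqrt -?powRrM 1?mulrC//; lra.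
by apply/orP; left; apply/eqP; ring.
Qed.

End max_moment.

(** * Selection among the estimators at one outcome of the noise *)

(** A deterministic statement, applied with [N] a bound on all normalized noise terms. The term [d]
    allows a positive noise scale for [Th i0] even when [w i0 i0] is 0; being at most every
    off-diagonal modulus, it is absorbed by the denominators of the statistics. *)
Lemma selection_error (R : realType) (k : nat) (w : 'I_k -> 'I_k -> R)
    (Th : 'I_k -> R) (Tp : 'I_k -> 'I_k -> R) (t M N Om d : R) (i0 ih : 'I_k) :
  let z i j := Num.max ((Tp i j - Th i) / (w i j + M * w i i))
                       ((Th i - Tp j i) / (w j i + M * w i i)) in
  let zsup i := sup [set z i j | j in [set j | j != i]] in
  (2 <= k)%N -> 0 < M -> 0 <= N -> 0 <= d ->
  (forall i j, 0 <= w i j <= Om) -> (forall i j, i != j -> 0 < w i j) ->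
  (forall i j, i != j -> d <= w i j) ->
  `|Th i0 - t| <= 2 * M * w i0 i0 + (2 * M * w i0 i0 + d) * N ->
  (forall j, i0 != j -> Tp i0 j - t <= w i0 j / 2 + w i0 j * N) ->
  (forall j, j != i0 -> - (w j i0 / 2) - w j i0 * N <= Tp j i0 - t) ->
  zsup ih <= zsup i0 -> `|Th ih - t| <= 3 * (1 + M) * Om * (1 + N).
Proof.
move=> z zsup k2 M0 N0 d0 wOm wpos dw h0 hu hl hsel.
have den i j i' : i' != j -> i = i' \/ i = j -> 0 < w i' j + M * w i i.
  move=> ij _; have := wpos _ _ ij; have /andP[+ _] := wOm i i.
  by move=> wi wij; rewrite ltr_pwDl// mulr_ge0// ltW.
have z0 j : j != i0 -> z i0 j <= 2 + 2 * N.
  move=> ji; have ij : i0 != j by rewrite eq_sym.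
  have d1 := den i0 j i0 ij (or_introl erefl).
  have d2 := den i0 i0 j ji (or_intror erefl).
  have /andP[w0 _] := wOm i0 i0.
  have Mw : 0 <= M * w i0 i0 by rewrite mulr_ge0// ltW.
  move: h0; rewrite ler_norml => /andP[h1 h2].
  have hu' := hu j ij; have hl' := hl j ji.
  have w1 := wpos _ _ ij; have w2 := wpos _ _ ji.
  have d1' := ler_wpM2r N0 (dw _ _ ij); have d2' := ler_wpM2r N0 (dw _ _ ji).
  have w1N := mulr_ge0 (ltW w1) N0; have w2N := mulr_ge0 (ltW w2) N0.
  have MwN := mulr_ge0 Mw N0.
  rewrite /z ge_max; apply/andP; split; rewrite ler_pdivrMr//; lra.
have [j0 j0i] : exists j, j != i0.
  have [E|E] := eqVneq i0 (Ordinal (ltnW k2)); last first.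
    by exists (Ordinal (ltnW k2)); rewrite eq_sym.
  by exists (Ordinal k2); rewrite E.
have zsup0 : zsup i0 <= 2 + 2 * N.
  apply: ge_sup; first by exists (z i0 j0), j0.
  by move=> _ [j ji <-]; exact: z0.
have [->|ihi] := eqVneq ih i0.
  have /andP[w0 wle] := wOm i0 i0.
  have dOm : d <= Om.
    by have /andP[_] := wOm j0 i0; apply: le_trans; exact: dw.
  apply: (le_trans h0).
  have MO := ler_wpM2l (ltW M0) wle.
  have MON := ler_wpM2r N0 MO; have dN := ler_wpM2r N0 dOm.
  have Mw : 0 <= M * w i0 i0 by rewrite mulr_ge0// ltW.
  have O0 : 0 <= Om by lra.
  have ON := mulr_ge0 O0 N0.
  have MwN := mulr_ge0 Mw N0.
  lra.
have zih : z ih i0 <= 2 + 2 * N.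
  apply: le_trans (le_trans hsel zsup0); apply: sup_ubound.
    exists (\big[Num.max/0]_j z ih j) => _ [j _ <-]; exact: le_bigmax.
  by exists i0 => //=; rewrite eq_sym.
have iih : i0 != ih by rewrite eq_sym.
have d1 := den ih i0 ih ihi (or_introl erefl).
have d2 := den ih ih i0 iih (or_intror erefl).
(* The first bound, with the lower bias of [Tp ih i0], controls [Th ih] from below; the second, with
   the upper bias of [Tp i0 ih], controls it from above. *)
move: zih; rewrite /z ge_max !ler_pdivrMr// => /andP[z1 z2].
have hu' := hu ih iih; have hl' := hl ih ihi.
have /andP[a0 aO] := wOm ih i0; have /andP[b0 bO] := wOm i0 ih.
have /andP[c0 cO] := wOm ih ih.
have O0 : 0 <= Om by lra.
have aN := ler_wpM2r N0 aO; have bN := ler_wpM2r N0 bO.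
have MO := ler_wpM2l (ltW M0) cO; have MON := ler_wpM2r N0 MO.
have MO0 : 0 <= M * Om by rewrite mulr_ge0// ltW.
have MO0N := mulr_ge0 MO0 N0; have ON := mulr_ge0 O0 N0.
rewrite ler_norml; apply/andP; split; lra.
Qed.

(** * Linear estimators of given risk *)

Section linear_estimator.
Context dO (Omega : measurableType dO) (R : realType) (P : probability Omega R).
Context d (X : measurableType d) (mu : {measure set X -> \bar R}).
Context (J : L2 mu -> Omega -> R) (D : set (L2 mu)) (T : L2 mu -> R).
Context (n : nat).
Hypothesis n_gt0 : (0 < n)%N.
Hypothesis J_approx : forall u, gaussian_approx P (J u) (l2norm u ^+ 2).

Local Notation r := (rate R n).

(** By [gaussian_approx_sqr] the risk is at least a quarter of squared bias plus variance, so bias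
    and standard deviation are each at most twice [M * w]. *)
Lemma linear_estimator_bias (G : set (L2 mu)) (a M w : R) (u : L2 mu) :
  0 <= M -> 0 <= w -> modulus T r G G = w%:E ->
  (ereal_sup [set 'E_P[fun w => ((a + obs J n u f w - T f) ^+ 2)%R] | f in G]
     <= (M ^+ 2)%:E * modulus T r G G ^+ 2)%E ->
  forall f, G f -> `|a + inner u f - T f| <= 2 * M * w /\
                   r * l2norm u <= 2 * M * w.
Proof.
move=> M0 w0 modE hsup f Gf.
have r0 : 0 < r by exact: rate_gt0.
have hE : ('E_P[fun w => ((a + obs J n u f w - T f) ^+ 2)%R] <=
    ((M * w) ^+ 2)%:E)%E.
  apply: le_trans (le_trans hsup _); first by apply: ereal_sup_ubound; exists f.
  by rewrite modE -EFin_expe -EFinM exprMn.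
have := gaussian_approx_sqr (a + inner u f - T f) r (J_approx u).
have -> : (\int[P]_w0 ((a + inner u f - T f + r * J u w0) ^+ 2)%:E =
    'E_P[fun w => ((a + obs J n u f w - T f) ^+ 2)%R])%E.
  rewrite unlock; apply: eq_integral => x _; congr (_%:E).
  by rewrite /obs; ring.
move=> h; have {h} : (((a + inner u f - T f) ^+ 2 + r ^+ 2 * l2norm u ^+ 2)%:E <=
    4%:E * ((M * w) ^+ 2)%:E)%E.
  by apply: (le_trans h); rewrite lee_wpmul2l.
rewrite -EFinM lee_fin -exprMn => h.
have Mw0 : 0 <= 2 * M * w by rewrite !mulr_ge0.
have b2 := sqr_ge0 (a + inner u f - T f); have r2 := sqr_ge0 (r * l2norm u).
have e4 : 4 * (M * w) ^+ 2 = (2 * M * w) ^+ 2 by ring.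
split.
  rewrite -ler_sqr ?nnegrE// real_normK ?num_real//; lra.
rewrite -ler_sqr ?nnegrE ?mulr_ge0 ?l2norm_ge0 ?(ltW r0)//; lra.
Qed.

(* Over a pair f, g of G at distance at most r, the bias varies by at most
   4 M w and <u, g - f> by at most 2 M w, so T g - T f <= 6 M w. *)
Lemma linear_estimator_modulus (G : set (L2 mu)) (a M w : R) (u : L2 mu) :
  0 < w -> modulus T r G G = w%:E ->
  (forall f, G f -> `|a + inner u f - T f| <= 2 * M * w /\
                    r * l2norm u <= 2 * M * w) -> 1 <= 6 * M.
Proof.
move=> w0 modE h; have : (modulus T r G G <= (6 * M * w)%:E)%E.
  apply: ub_ereal_sup => _ [f [g [Gf Gg fg ->]]]; rewrite lee_fin.
  have [+ ur] := h f Gf; rewrite ler_norml => /andP[f1 _].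
  have [+ _] := h g Gg; rewrite ler_norml => /andP[_ g1].
  have := inner_le u (g - f); rewrite innerDr innerNr => i1.
  have := ler_wpM2l (l2norm_ge0 u) fg => i2.
  rewrite mulrC in ur.
  have f2 := (h f Gf).1; have g2 := (h g Gg).1.
  move: f2 g2; rewrite !ler_norml => /andP[f2 f3] /andP[g2 g3]; lra.
by rewrite modE lee_fin -{1}(mul1r w) ler_pM2r.
Qed.

Lemma noise_subgaussian (u : L2 mu) (c s : R) : 0 <= c -> c * l2norm u <= 1 ->
  (\int[P]_w (expR (s * (c * J u w)))%:E <= (expR (s ^+ 2 / 2))%:E)%E.
Proof.
move=> c0 cu; under eq_integral do rewrite mulrA.
apply: (le_trans (gaussian_approx_expR _ (J_approx u))).
rewrite lee_fin ler_expR ler_pM2r// exprMn -mulrA -exprMn ler_piMr ?sqr_ge0//.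
by rewrite expr_le1// mulr_ge0// l2norm_ge0.
Qed.

End linear_estimator.

(** * Assembly of the risk bound for the selected estimator *)

Theorem theorem4 (R : realType) :
  exists C : R -> R, forall p : R, 1 <= p ->
  forall (dO : measure_display) (Omega : measurableType dO)
    (P : probability Omega R)
    (d : measure_display) (X : measurableType d)
    (mu : {measure set X -> \bar R}) (J : L2 mu -> Omega -> R)
    (n k : nat) (D : set (L2 mu)) (T : L2 mu -> R)
    (F : 'I_k -> set (L2 mu)) (M : R)
    (a : 'I_k -> R) (u : 'I_k -> L2 mu)
    (ap : 'I_k -> 'I_k -> R) (up : 'I_k -> 'I_k -> L2 mu)
    (ihat : L2 mu -> Omega -> 'I_k),
  gaussian_noise P J ->
  (0 < n)%N -> (2 <= k)%N -> 0 < M ->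
  linear_functional_on D T ->
  (forall i, F i `<=` D) ->
  (forall i, l2closed (F i)) ->
  (forall i, convex_set (F i : set (convex_lmodType (L2 mu)))) ->
  (forall i j, F i `&` F j !=set0) ->
  (forall i j, i != j -> (0 < modulus T 1 (F i) (F j))%E) ->
  (forall i j, (modulus T (rate R n) (F i) (F j) < +oo)%E) ->
  (forall i,
    (ereal_sup [set 'E_P[fun w => ((That J n a u i f w - T f) ^+ 2)%R]
                | f in F i]
     <= (M ^+ 2)%:E * modulus T (rate R n) (F i) (F i) ^+ 2)%E) ->
  (forall i j, i != j -> pair_coefs T n (F i) (F j) (ap i j) (up i j)) ->
  is_selector J n T F M a u ap up ihat ->
  (ereal_sup
     [set 'E_P[fun w => (`|That_star J n a u ihat f w - T f| `^ p)%R]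
      | f in \bigcup_i F i]
   <= (C p * M `^ p * (ln k%:R) `^ (p / 2))%:E
      * modulus T (rate R n) (\bigcup_i F i) (\bigcup_i F i) `^ p)%E.
Proof.
(* The 21 is 3 times 7: the selection error carries the factor [3 * (1 + M)], and [1 <= 6 * M] gives
   [1 + M <= 7 * M]. The other factor comes from [subgaussian_max_moment]. *)
exists (fun p => 21 `^ p * (8 `^ p + 5 * (2 * p) `^ p)) => p p1.
move=> dO Omega P d X mu J n k D T F M a u ap up ihat noise n0 k2 M0 linT FD _.
move=> convF FF mod1 modfin risk coefs sel.
have Japp := gaussian_noise_approx noise.
have r0 : 0 < rate R n by exact: rate_gt0.
set U := \bigcup_i F i.
set C := 21 `^ p * _.
have C0 : 0 < C.
  have p2 : 0 < (2 * p) `^ p by apply: powR_gt0; lra.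
  have p8 : 0 < 8 `^ p :> R by apply: powR_gt0.
  by rewrite mulr_gt0 ?powR_gt0//; lra.
have k0 : 0 < k%:R :> R by rewrite ltr0n (leq_trans _ k2).
have lnk : 0 < ln k%:R :> R by rewrite ln_gt0// ltr1n.
have c0 : 0 < C * M `^ p * ln k%:R `^ (p / 2) by rewrite mulr_gt0 ?powR_gt0// mulr_gt0 ?powR_gt0.
have i1 : 'I_k := Ordinal (ltnW k2).
pose w := omega n T F.
have wE i j : modulus T (rate R n) (F i) (F j) = (w i j)%:E.
  exact: (modulus_rateE n0 (FF i j) (modfin i j)).
have w0 i j : 0 <= w i j by exact: (modulus_rate_ge0 T n0 (FF i j)).
have FU i : F i `<=` U by move=> f Ff; exists i.
have modU0 : (0 <= modulus T (rate R n) U U)%E.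
  by rewrite (le_trans _ (le_modulus _ _ (FU i1) (FU i1)))// wE lee_fin.
(* If the modulus of the union is infinite, so is the right-hand side, because its constant is
   positive. *)
case UE : (modulus T (rate R n) U U) => [Om||]; last 2 first.
- by rewrite poweRyr ?gt0_muley ?lte_fin ?leey// gt_eqF//; lra.
- by rewrite UE in modU0.
have wOm i j : 0 <= w i j <= Om.
  by rewrite w0 -lee_fin -wE -UE le_modulus.
have Om0 : 0 <= Om by rewrite -lee_fin -UE.
have pairs i j (ij : i != j) := pair_coefs_bias linT n0 (convF i) (convF j)
  (@FD i) (@FD j) (FF i j) (modfin i j) (mod1 i j ij) (coefs i j ij).
have exfg i j (ij : i != j) : exists f g, [/\ F i f, F j g & T f < T g].
  have /ereal_sup_gt[_ [f [g [Ff Fg _ ->]]]] := mod1 i j ij.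
  by rewrite lte_fin subr_gt0 => Tfg; exists f, g.
have wpos i j : i != j -> 0 < w i j.
  move=> /exfg[f [g [Ff Fg Tfg]]].
  exact: (modulus_rate_gt0 linT n0 (convF i) (convF j) (@FD i) (@FD j) (FF i j)
    (modfin i j) Ff Fg).
have bias i f := @linear_estimator_bias _ _ _ P _ _ mu J T n n0 Japp (F i) (a i) M
  (w i i) (u i) (ltW M0) (w0 i i) (wE i i) (risk i) f.
have M6 : 1 <= 6 * M.
  (* Take [f] and [g] in two different sets with [T f < T g], and a common point [h]: either
     [T f < T h] within the first set or [T h < T g] within the second. *)
  have [i wi] : exists i, 0 < w i i.
    pose o0 := Ordinal (ltnW k2); pose o1 := Ordinal k2.
    have [f [g [Ff Fg Tfg]]] := exfg o0 o1 isT.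
    have [h [h0 h1]] := FF o0 o1.
    have pos i f' g' : F i f' -> F i g' -> T f' < T g' -> 0 < w i i.
      exact: (modulus_rate_gt0 linT n0 (convF i) (convF i) (@FD i) (@FD i) (FF i i)
        (modfin i i)).
    have [Tfh|Thf] := ltP (T f) (T h); first by exists o0; exact: pos Tfh.
    by exists o1; apply: (pos o1 h g) => //; exact: le_lt_trans Tfg.
  exact: (linear_estimator_modulus wi (wE i i) (bias i)).
(* [w i i] may vanish, so the noise scale of [That i] is enlarged by a positive amount that stays
   below every off-diagonal modulus. The default value 1 keeps it positive. *)
pose dmin := \big[Num.min/1]_(ij : 'I_k * 'I_k | ij.1 != ij.2) w ij.1 ij.2.
have d0 : 0 < dmin by apply: lt_bigmin => // -[i j]; exact: wpos.
have dw i j : i != j -> dmin <= w i j.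
  by move=> ij; exact: (bigmin_le_cond 1 (fun x => w x.1 x.2) (j := (i, j))).
pose sc i := 2 * M * w i i + dmin.
have sc0 i : 0 < sc i by rewrite ltr_wpDl// !mulr_ge0// ltW.
(* The k estimators and k ^ 2 pairs make at most 2 k ^ 2 variables; the factor [(i != j)%:R] cancels
   the diagonal pairs, whose coefficients are unconstrained. *)
pose noises (x : 'I_k + 'I_k * 'I_k) : Omega -> R :=
  match x with
  | inl i => fun om => rate R n / sc i * J (u i) om
  | inr (i, j) => fun om => (i != j)%:R * J (up i j) om
  end.
apply: ub_ereal_sup => _ [f [i0 _ Ff] <-]; rewrite poweR_EFin -EFinM.
have mJ v : measurable_fun setT (J v) by case: (Japp v).
have mThat i : measurable_fun setT (That J n a u i f).
  by apply: measurable_funD => //; apply: measurable_funD => //;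
    exact: measurable_funM.
have [msel hsel] := sel f.
pose Y om := That_star J n a u ihat f om - T f.
have mY : measurable_fun setT Y.
  apply: measurable_funB => //.
  (* The selected estimator is a finite sum over the values of the selector, whose level sets are
     measurable. *)
  rewrite (_ : That_star _ _ _ _ _ _ =
      (fun om => \sum_i \1_(ihat f @^-1` [set i]) om * That J n a u i f om)).
    apply: measurable_sum => i; apply: measurable_funM; last exact: mThat.
    exact/measurable_indic/msel.
  apply/funext => om; rewrite (bigD1 (ihat f om))//= big1 => [|i ii].
    by rewrite indicE mem_set// mul1r addr0.
  by rewrite indicE memNset ?mul0r//= => /eqP; rewrite eq_sym (negbTE ii).
have A0 : 0 <= 21 * M * Om by rewrite !mulr_ge0// ltW.
rewrite unlock.
have := @subgaussian_max_moment _ Omega R P _ noises Y (21 * M * Om) p k p1 A0 k2.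
have Cn : (8 `^ p + 5 * (2 * p) `^ p) * (21 * M * Om) `^ p * ln k%:R `^ (p / 2) =
    C * M `^ p * ln k%:R `^ (p / 2) * Om `^ p.
  have -> : (21 * M * Om) `^ p = 21 `^ p * M `^ p * Om `^ p.
    by rewrite powRM// ?mulr_ge0 ?(ltW M0)// powRM// ltW.
  by rewrite /C; ring.
rewrite -Cn; apply => //.
- by rewrite card_sum card_prod card_ord mul2n -addnn -mulnn leq_add2r leq_pmulr// ltnW.
- by case=> [i|[i j]] /=; exact: measurable_funM.
- case=> [i|[i j]] s /=.
    apply: (noise_subgaussian Japp); first by rewrite divr_ge0 ?ltW.
    have [f' [h0 _]] := FF i i; have [_ hr] := bias i f' h0.
    rewrite mulrAC ler_pdivrMr// mul1r /sc; lra.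
  apply: (noise_subgaussian Japp) => //.
  have [_|ij] := eqVneq i j; first by rewrite mul0r.
  by rewrite mul1r; case: (pairs i j ij).
move=> om N N0 hN.
have hi i : `|rate R n * J (u i) om| <= sc i * N.
  have := hN (inl i) => /=.
  rewrite mulrAC normrM [X in _ * X]gtr0_norm ?invr_gt0// ler_pdivrMr//.
  by rewrite (mulrC N).
have hij i j : i != j -> `|J (up i j) om| <= N.
  by move=> ij; have := hN (inr (i, j)); rewrite /= ij mul1r.
(* Slope times noise level is exactly [w i j], so the error of a pair estimator is its bias plus
   noise on the scale [w i j]. *)
have pairE i j g : That_pair J n T F ap up i j g om - T g =
    ap i j + Num.sqrt (n%:R * pair_variance T n (F i) (F j)) * inner (up i j) g
      - T g + w i j * J (up i j) om.
  have s := slope_rate T n0 (FF i j); rewrite /That_pair /obs.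
  by rewrite -[w i j]s; ring.
have sel_err := @selection_error R k w (fun i => That J n a u i f om)
  (fun i j => That_pair J n T F ap up i j f om) (T f) M N Om dmin i0 (ihat f om)
  k2 M0 N0 (ltW d0) wOm wpos dw.
apply: (@le_trans _ _ (3 * (1 + M) * Om * (1 + N))); last first.
  have N1 : 0 <= 1 + N by lra.
  rewrite ler_wpM2r// ler_wpM2r//; lra.
apply: sel_err.
- have [b _] := bias i0 f Ff.
  have -> : That J n a u i0 f om - T f =
      (a i0 + inner (u i0) f - T f) + rate R n * J (u i0) om.
    by rewrite /That /obs; ring.
  by rewrite (le_trans (ler_normD _ _))// lerD.
- move=> j ij; rewrite pairE; have [_ b _] := pairs i0 j ij.
  rewrite lerD ?b//.
  by rewrite ler_wpM2l// (le_trans (ler_norm _))// hij.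
- move=> j ji; rewrite pairE; have [_ _ b] := pairs j i0 ji.
  have := b f Ff => hb; have := hij j i0 ji; rewrite ler_norml => /andP[h1 _].
  have := ler_wpM2l (w0 j i0) h1; rewrite mulrN => h2.
  by rewrite lerD.
- exact: hsel.
Qed.
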